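(* Let $(F,G)$ be a Jacobi pair with $F,G\in\mathbb C[x^{\pm1},y]$, $m=\deg_yF$, $n=\deg_yG$, $m_0=\deg_x f_0$ (where $f_0$ is the coefficient of $y^m$ in $F$), such that $0<m_0<m$, the prime degree $p(F)\le0$, $2\le m<n$ and $m\nmid n$; regard $F,G$ as elements of $\mathbb C[x^{\pm\frac1N},y]$ for some sufficiently large $N\in\mathbb N$ (enlarged if necessary after variable changes). Suppose $(\dot m_0,\dot m)\in\mathrm{Supp}\,F$ is a vertex of $\mathrm{Supp}\,F$ with $0<\dot m_0<\dot m$, $\dot m_0\in\mathbb Q_+$, $\dot m\in\mathbb N$, and let $\dot L$ be the edge of $\mathrm{Supp}\,F$ on the right-hand side of the Newton polygon of $F$ having $(\dot m_0,\dot m)$ as its top vertex; suppose that its slope is either $\frac{\dot q}{\dot p}>0$ or $\infty$ (in the latter case write the slope as $\frac{\dot q}{\dot p}$ with $\dot p=0$, $\dot q=1$). Suppose correspondingly that $(\dot n_0,\dot n)$ is a vertex of $\mathrm{Supp}\,G$ such that $\frac{\dot n_0}{\dot m_0}=\frac{\dot n}{\dot m}=\frac nm$, and that the edge of $\mathrm{Supp}\,G$ whose top vertex is $(\dot n_0,\dot n)$ also has slope $\frac{\dot q}{\dot p}$. Assume $\dot m\ge2$ and $$-\frac{\dot p}{\dot q}>-\frac{\dot m_0}{\dot m}+\frac{\dot m-\dot m_0}{\dot m(\dot m+\dot n-1)}=-\frac{\dot m_0+\dot n_0-1}{\dot m+\dot n-1}.$$ Then either $\dot F_{\langle0\rangle}$,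 the part of $F$ whose support is the edge $\dot L$, has only one irreducible factor; or else, if necessary after changing $(x,y)$ to $(x,y+\alpha_0x^{-\dot p/\dot q})$ for some $\alpha_0\in\mathbb C$, there are a vertex $(\ddot m_0,\ddot m)\in \mathrm{Supp}\,F$ of $\mathrm{Supp}\,F$ and a corresponding vertex $(\ddot n_0,\ddot n)$ of $\mathrm{Supp}\,G$ such that $\frac{\ddot n_0}{\ddot m_0}=\frac{\ddot n}{\ddot m}=\frac nm$ and $$0<\ddot m_0<\ddot m<\dot m,\qquad \ddot m_0\in\mathbb Q_+,\qquad 2\le\ddot m\in\mathbb N.$$
   Context: Bracket: $[F,G]=(\partial_xF)(\partial_yG)-(\partial_yF)(\partial_xG)$. Write $F=\sum_{i\ge0}f_iy^{m-i}$ with $f_0\ne0$. The prime degree $p(F)$ is the number $p\in\mathbb Q$ such that $\deg_xf_i\le\deg_xf_0+pi$ for all $i$ with equality for at least one $i\ge1$ ($-\infty$ if $F=f_0y^m$; $+\infty$ if it does not exist). A Jacobi pair is a pair $(F,G)$ with $[F,G]\in\mathbb C\setminus\{0\}$, $p(F)\neq\pm\infty$ and $p(G)\le p(F)$. For $F=\sum f_{ij}x^iy^j$ (with $i\in\frac1N\mathbb Z$, $j\in\mathbb Z_+$), $\mathrm{Supp}\,F=\{(i,j):f_{ij}\ne0\}$. The Newton polygon of $F$ is the minimal polygon such that the region surrounded by it contains $(\mathrm{Supp}\,F)\cup\{0\}$; its vertices and edges are called the vertices and edges of $\mathrm{Supp}\,F$. The numbers $\dot p\in\mathbb Z_+$,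 $\dot q\in\mathbb N$ are integers. Irreducible factors are taken in $\mathcal A[y]$ (up to multiplicity and units), where $\mathcal A$ is the (algebraically closed) field of series $\sum_{i\in\mathbb Q}f_ix^i$, $f_i\in\mathbb C$, with exponents in $\alpha-\frac1\beta\mathbb Z_+$ for some integers $\alpha,\beta$ with $\beta>0$. *)

(* Defs.v *)
From HB Require Import structures.
From mathcomp Require Import all_boot all_order all_algebra.
From mathcomp Require Import mathcomp_extra boolp classical_sets functions.
From mathcomp Require Import cardinality fsbigop reals ereal interval_inference.
From mathcomp Require Import convex.
From mathcomp Require Import complex.
From mathcomp Require Import ring lra zify.

Set Implicit Arguments.
Unset Strict Implicit.
Unset Printing Implicit Defensive.

Import Order.TTheory GRing.Theory Num.Theory.

Local Open Scope classical_set_scope.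
Local Open Scope ring_scope.

Section PowerSeries.
Variable K : fieldType.
Implicit Types s t u : nat -> K.

Definition psmul s t n := \sum_(j < n.+1) s j * t (n - j)%N.

Lemma psmul_poly N s t n : (n < N)%N ->
  psmul s t n = ((\poly_(i < N) s i) * (\poly_(i < N) t i))`_n.
Proof.
move=> nN; rewrite coefM; apply: eq_bigr => j _; rewrite !coef_poly.
by rewrite (leq_ltn_trans (leq_subr _ _) nN) (leq_ltn_trans (leq_ord j) nN).
Qed.

Lemma psmulC s t n : psmul s t n = psmul t s n.
Proof. by rewrite !(@psmul_poly n.+1)// mulrC. Qed.

Lemma psmulA s t u n : psmul s (psmul t u) n = psmul (psmul s t) u n.
Proof.
pose P v := \poly_(i < n.+1) v i : {poly K}.
have E v i : (i <= n)%N -> (P v)`_i = v i by move=> ni; rewrite coef_poly ltnS ni.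
transitivity (P s * (P t * P u))`_n.
  rewrite coefM; apply: eq_bigr => j _; rewrite E ?leq_ord//.
  by rewrite (@psmul_poly n.+1)// ltnS leq_subr.
rewrite mulrA coefM; apply: eq_bigr => j _; rewrite (E u) ?leq_subr//.
by rewrite (@psmul_poly n.+1).
Qed.

Fixpoint psinv_seq s n : seq K :=
  if n is n'.+1 then
    let l := psinv_seq s n' in
    rcons l (if n' == 0%N then (s 0%N)^-1
             else - (s 0%N)^-1 * \sum_(j < n') s (n' - j)%N * l`_j)
  else [::].

Lemma size_psinv_seq s n : size (psinv_seq s n) = n.
Proof. by elim: n => //= n IH; rewrite size_rcons IH. Qed.

Definition psinv s n := (psinv_seq s n.+1)`_n.

Lemma nth_psinv_seq s n j : (j < n)%N -> (psinv_seq s n)`_j = psinv s j.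
Proof.
elim: n => // n IH; rewrite ltnS leq_eqVlt => /predU1P[->//|jn].
by rewrite [LHS]/= nth_rcons size_psinv_seq jn IH.
Qed.

Lemma psinvP s n : s 0%N != 0 -> psmul s (psinv s) n = (n == 0%N)%:R.
Proof.
move=> s0; have vE : psinv s n = if n == 0%N then (s 0%N)^-1
    else - (s 0%N)^-1 * \sum_(j < n) s (n - j)%N * psinv s j.
  rewrite /psinv /= nth_rcons size_psinv_seq ltnn eqxx.
  case: eqP => // _; congr (_ * _); apply: eq_bigr => j _.
  by rewrite nth_psinv_seq.
rewrite psmulC /psmul; case: n vE => [|n] vE.
  by rewrite big_ord_recr big_ord0 /= add0r vE mulVf.
rewrite big_ord_recr/= vE/= subnn mulrAC mulNr mulVf// mulN1r.
by apply/eqP; rewrite subr_eq0; apply/eqP/eq_bigr => j _; rewrite mulrC.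
Qed.

End PowerSeries.

Section Puiseux.
Variable K : fieldType.
Implicit Types f g h : rat -> K.

Definition exponents_in (a : rat) (b : nat) f :=
  forall i, f i != 0 -> exists k : nat, i = a - k%:R / b%:R.

Definition is_puiseux f := exists (alpha : int) (beta : nat),
  (0 < beta)%N /\ exponents_in alpha%:~R beta f.

(* The field of series in x over K with exponents in alpha - (1/beta) Z_+;
   f : puiseux stands for the sum of the f i * x^i. *)
Record puiseux := Puiseux {
  pcoef :> rat -> K ;
  pcoefP : `[< is_puiseux pcoef >] }.

HB.instance Definition _ := [isSub of puiseux for pcoef].
HB.instance Definition _ := gen_eqMixin puiseux.
HB.instance Definition _ := gen_choiceMixin puiseux.

Lemma puiseuxP (f g : puiseux) : (forall i, f i = g i) -> f = g.
Proof. by move=> fg; apply/val_inj/funext. Qed.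

Lemma exponents_in_mulb a b c f : (0 < b)%N -> (0 < c)%N ->
  exponents_in a b f -> exponents_in a (b * c) f.
Proof.
move=> b0 c0 fa i /fa[k ->]; exists (k * c)%N.
by rewrite !natrM; field; rewrite !pnatr_eq0 -!lt0n b0 c0.
Qed.

Lemma exponents_in_le (a a' : int) b f : (0 < b)%N -> a <= a' ->
  exponents_in a%:~R b f -> exponents_in a'%:~R b f.
Proof.
move=> b0 aa' fa i /fa[k ->]; exists (k + `|a' - a| * b)%N.
rewrite natrD natrM natr_absz ger0_norm ?subr_ge0// rmorphB/=.
by field; rewrite !pnatr_eq0 -!lt0n.
Qed.

Lemma exponents_in_puiseux a b f : (0 < b)%N ->
  exponents_in a b f -> is_puiseux f.
Proof.
move=> b0 fa; pose d := `|denq a|%N; pose n := `|numq a|%N.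
have d0 : (0 < d)%N by rewrite absz_gt0 denq_neq0.
have dE : (d%:R : rat) = (denq a)%:~R by rewrite natr_absz ger0_norm ?denq_ge0.
have nd : (numq a <= (n * d)%:Z).
  rewrite (le_trans (lez_abs _))// lez_nat leq_pmulr//.
exists n%:Z, (d * b)%N; split; first by rewrite muln_gt0 d0.
move=> i /fa[k ->]; exists (`|(n * d)%:Z - numq a| * b + k * d)%N.
rewrite natrD !natrM natr_absz ger0_norm ?subr_ge0// rmorphB/=.
rewrite -!pmulrn natrM -{1}(divq_num_den a) -dE.
by field; rewrite !pnatr_eq0 -!lt0n d0 b0.
Qed.

Lemma common (f g h : puiseux) : exists (a : int) (b : nat),
  [/\ (0 < b)%N, exponents_in a%:~R b f, exponents_in a%:~R b g
    & exponents_in a%:~R b h].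
Proof.
have /asboolP[af [bf [bf0 Hf]]] := pcoefP f.
have /asboolP[ag [bg [bg0 Hg]]] := pcoefP g.
have /asboolP[ah [bh [bh0 Hh]]] := pcoefP h.
exists (Num.max (Num.max af ag) ah), (bf * bg * bh)%N.
have b0 : (0 < bf * bg * bh)%N by rewrite !muln_gt0 bf0 bg0.
split => //.
- apply: (exponents_in_le b0 (a := af)); first by rewrite !le_max lexx.
  by rewrite -mulnA; apply: exponents_in_mulb; rewrite ?muln_gt0 ?bg0.
- apply: (exponents_in_le b0 (a := ag)); first by rewrite !le_max lexx orbT.
  rewrite (mulnC bf) -mulnA.
  by apply: exponents_in_mulb; rewrite ?muln_gt0 ?bf0.
- apply: (exponents_in_le b0 (a := ah)); first by rewrite !le_max lexx !orbT.
  rewrite mulnC.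
  by apply: exponents_in_mulb; rewrite ?muln_gt0 ?bf0.
Qed.

Definition ser a b f : nat -> K := fun n => f (a - n%:R / b%:R).

Lemma ser_ext a b f g : exponents_in a b f -> exponents_in a b g ->
  ser a b f =1 ser a b g -> f =1 g.
Proof.
move=> fa ga fg i; have [fi0|/fa[k ->]] := eqVneq (f i) 0; last exact: fg.
have [gi0|/ga[k kE]] := eqVneq (g i) 0; first by rewrite fi0 gi0.
by rewrite kE; exact: fg.
Qed.

Definition conv_coef f g : rat -> K :=
  fun k => \sum_(i \in [set: rat]) f i * g (k - i).

Lemma conv_exponents a a' b f g : (0 < b)%N ->
  exponents_in a b f -> exponents_in a' b g ->
  exponents_in (a + a') b (conv_coef f g).
Proof.
move=> b0 fa ga k; apply: contra_neqP => nk; apply: fsbig1 => i _.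
have [->|/fa[j ij]] := eqVneq (f i) 0; first by rewrite mul0r.
have [->|/ga[l il]] := eqVneq (g (k - i)) 0; first by rewrite mulr0.
exfalso; apply: nk; exists (j + l)%N.
rewrite -[k](subrK i) il ij natrD; ring.
Qed.

Lemma ser_conv a a' b f g : (0 < b)%N ->
  exponents_in a b f -> exponents_in a' b g ->
  ser (a + a') b (conv_coef f g) =1 psmul (ser a b f) (ser a' b g).
Proof.
move=> b0 fa ga n; rewrite /ser /conv_coef /psmul.
have bn0 : (b%:R : rat) != 0 by rewrite pnatr_eq0 -lt0n.
have inj : injective (fun j : nat => a - j%:R / b%:R).
  by move=> i j /addrI/oppr_inj/(divIf bn0)/eqP; rewrite eqr_nat => /eqP.
rewrite (fsbigE [seq a - j%:R / b%:R | j <- iota 0 n.+1]) //; last 2 first.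
- by rewrite (map_inj_uniq inj) iota_uniq.
- move=> i _ ni.
  have [->|/fa[j ij]] := eqVneq (f i) 0; first by rewrite mul0r.
  have [->|/ga[l il]] := eqVneq (g (a + a' - n%:R / b%:R - i)) 0; first by rewrite mulr0.
  exfalso; move/negP: ni; apply; rewrite ij; apply/mapP; exists j => //.
  rewrite mem_iota/= add0n ltnS.
  have : n%:R / b%:R = (j + l)%:R / b%:R :> rat.
    by rewrite natrD; move: il; rewrite ij; lra.
  by move=> /(divIf bn0)/eqP; rewrite eqr_nat => /eqP ->; rewrite leq_addr.
rewrite big_map (eq_bigl xpredT); last by move=> i; rewrite in_setT.
have -> : iota 0 n.+1 = index_iota 0 n.+1 by rewrite /index_iota subn0.
rewrite big_mkord; apply: eq_bigr => j _.
congr (f _ * g _); rewrite natrB ?leq_ord//; by field.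
Qed.

Lemma pzero_subproof : `[< is_puiseux (fun=> 0) >].
Proof. by apply/asboolP; exists 0, 1%N; split=> // i; rewrite eqxx. Qed.
Definition pzero := Puiseux pzero_subproof.

Lemma pmono_subproof (c : K) (e : rat) :
  `[< is_puiseux (fun i => if i == e then c else 0) >].
Proof.
apply/asboolP/(@exponents_in_puiseux e 1) => // i.
by case: (i =P e) => [-> _|]; [exists 0%N; lra | rewrite eqxx].
Qed.
(* The monomial c x^e. *)
Definition pmono c e : puiseux := Puiseux (pmono_subproof c e).

Lemma padd_subproof (f g : puiseux) : `[< is_puiseux (fun i => f i + g i) >].
Proof.
have [a [b [b0 fa ga _]]] := common f g f.
apply/asboolP; exists a, b; split=> // i.
have [->|/fa//] := eqVneq (f i) 0; by rewrite add0r => /ga.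
Qed.
Definition padd (f g : puiseux) : puiseux := Puiseux (padd_subproof f g).

Lemma popp_subproof (f : puiseux) : `[< is_puiseux (fun i => - f i) >].
Proof.
have [a [b [b0 fa _ _]]] := common f f f.
by apply/asboolP; exists a, b; split=> // i; rewrite oppr_eq0 => /fa.
Qed.
Definition popp (f : puiseux) : puiseux := Puiseux (popp_subproof f).

Lemma pmul_subproof (f g : puiseux) : `[< is_puiseux (conv_coef f g) >].
Proof.
have [a [b [b0 fa ga _]]] := common f g f.
exact/asboolP/(exponents_in_puiseux b0 (conv_exponents b0 fa ga)).
Qed.
Definition pmul (f g : puiseux) : puiseux := Puiseux (pmul_subproof f g).

Lemma paddA : associative padd.
Proof. by move=> f g h; apply: puiseuxP => i; exact: addrA. Qed.
Lemma paddC : commutative padd.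
Proof. by move=> f g; apply: puiseuxP => i; exact: addrC. Qed.
Lemma padd0 : left_id pzero padd.
Proof. by move=> f; apply: puiseuxP => i; exact: add0r. Qed.
Lemma paddN : left_inverse pzero popp padd.
Proof. by move=> f; apply: puiseuxP => i; exact: addNr. Qed.

HB.instance Definition _ := GRing.isZmodule.Build puiseux paddA paddC padd0 paddN.

Lemma pmulC : commutative pmul.
Proof.
move=> f g; have [a [b [b0 fa ga _]]] := common f g f.
apply: puiseuxP; apply: (ser_ext (conv_exponents b0 fa ga)).
  exact: conv_exponents.
by move=> n; rewrite !ser_conv// psmulC.
Qed.

Lemma pmulA : associative pmul.
Proof.
move=> f g h; have [a [b [b0 fa ga ha]]] := common f g h.
apply: puiseuxP; pose A : rat := a%:~R.
have fg := conv_exponents b0 fa ga; have gh := conv_exponents b0 ga ha.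
have l := conv_exponents b0 fa gh; have r := conv_exponents b0 fg ha.
rewrite -addrA in r; apply: (ser_ext l r) => n.
rewrite (ser_conv b0 fa gh) addrA (ser_conv b0 fg ha).
transitivity (psmul (ser A b f) (psmul (ser A b g) (ser A b h)) n).
  by apply: eq_bigr => j _; rewrite ser_conv.
rewrite psmulA; apply: eq_bigr => j _; by rewrite ser_conv.
Qed.

Lemma pmul1 : left_id (pmono 1 0) pmul.
Proof.
move=> f; apply: puiseuxP => k /=; rewrite /conv_coef.
rewrite (fsbigE [:: 0 : rat])//; last first.
  by move=> i _ /=; rewrite inE => /negPf ->; rewrite mul0r.
rewrite big_cons big_nil in_setT eqxx mul1r subr0; exact: addr0.
Qed.

Lemma pmulDl : left_distributive pmul +%R.
Proof.
move=> f g h; have [a [b [b0 fa ga ha]]] := common f g h.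
have fga : exponents_in a%:~R b (f + g : puiseux).
  move=> i; have [|/fa//] := eqVneq (f i) 0.
  by rewrite [X in X != 0]/= => ->; rewrite add0r => /ga.
apply: puiseuxP; apply: (ser_ext (conv_exponents b0 fga ha)).
  move=> i /=; have [->|/(conv_exponents b0 fa ha)//] := eqVneq (conv_coef f h i) 0.
  by rewrite add0r => /(conv_exponents b0 ga ha).
move=> n; rewrite ser_conv// /psmul.
rewrite [RHS]/ser /= -![conv_coef _ _ _]/(ser _ _ _ n).
rewrite -[in RHS]/(ser (a%:~R + a%:~R) b (conv_coef f h) n).
rewrite -[X in _ + X]/(ser (a%:~R + a%:~R) b (conv_coef g h) n).
rewrite !ser_conv// /psmul -big_split/=; apply: eq_bigr => j _.
by rewrite -mulrDl.
Qed.

Lemma pone_neq0 : pmono 1 0 != 0.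
Proof.
by apply/eqP => /(congr1 (fun f : puiseux => f 0))/eqP; rewrite [X in X == _]/= oner_eq0.
Qed.

HB.instance Definition _ := GRing.Zmodule_isComNzRing.Build puiseux
  pmulA pmulC pmul1 pmulDl pone_neq0.

Lemma puiseux_lead (f : puiseux) : f != 0 ->
  exists d b, [/\ (0 < b)%N, exponents_in d b f & f d != 0].
Proof.
move=> f0; have [a [b [b0 fa _ _]]] := common f f f.
have ex : exists n, ser a%:~R b f n != 0.
  apply: contrapT => /forallNP h; move/eqP: f0; apply; apply: puiseuxP => i.
  have [->//|fi] := eqVneq (f i) 0; have [k kE] := fa _ fi.
  by exfalso; apply: (h k); rewrite /ser -kE.
case: (ex_minnP ex) => m m0 mm.
exists (a%:~R - m%:R / b%:R), b; split=> // i fi.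
have [k kE] := fa _ fi; have mk : (m <= k)%N by apply: mm; rewrite /ser -kE.
by exists (k - m)%N; rewrite kE natrB//; ring.
Qed.

Lemma puiseux_inv (f : puiseux) : f != 0 -> exists g : puiseux, g * f = 1.
Proof.
move=> /puiseux_lead[d [b [b0 fd f0]]].
have bn0 : (b%:R : rat) != 0 by rewrite pnatr_eq0 -lt0n.
pose t := psinv (ser d b f).
pose g i := if pselect (exists k : nat, i = - d - k%:R / b%:R) is left e
            then t (projT1 (cid e)) else 0.
have gd : exponents_in (- d) b g.
  by move=> i; rewrite /g; case: pselect => //; rewrite eqxx.
have gt : ser (- d) b g =1 t.
  move=> n; rewrite /ser /g; case: pselect => [e|[]]; last by exists n.
  case: cid => k /= /addrI/oppr_inj/(divIf bn0)/eqP.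
  by rewrite eqr_nat => /eqP ->.
have gP : `[< is_puiseux g >] by exact/asboolP/(exponents_in_puiseux b0 gd).
exists (Puiseux gP); rewrite mulrC; apply: puiseuxP.
apply: (ser_ext (conv_exponents b0 fd gd)).
  move=> i /=; case: (i =P 0) => [-> _|]; last by rewrite eqxx.
  by exists 0%N; rewrite mul0r subrr subr0.
move=> n; rewrite ser_conv//.
transitivity (psmul (ser d b f) t n).
  by apply: eq_bigr => j _; rewrite gt.
rewrite psinvP; last by rewrite /ser mul0r subr0.
rewrite /ser /= subrr sub0r oppr_eq0 mulf_eq0 invr_eq0 (negPf bn0) orbF.
by rewrite pnatr_eq0; case: eqP.
Qed.

Definition pinv (f : puiseux) : puiseux :=
  if pselect (exists g : puiseux, g * f = 1) is left e
  then projT1 (cid e) else 0.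

Lemma pmulV (f : puiseux) : f != 0 -> pinv f * f = 1.
Proof.
move=> /puiseux_inv e; rewrite /pinv; case: pselect => // e'.
by case: cid.
Qed.

Lemma pinv0 : pinv 0 = 0.
Proof.
rewrite /pinv; case: pselect => // e; exfalso; case: e => g /eqP.
by rewrite mulr0 eq_sym oner_eq0.
Qed.

HB.instance Definition _ := GRing.ComNzRing_isField.Build puiseux pmulV pinv0.

End Puiseux.

Section JacobiPairs.
Variable K : numFieldType.
Local Notation A := (puiseux K).
Implicit Types (f : A) (F G : {poly A}).

(* Polynomials in y over the field A contain K[x^{+-1/N}, y] for every N, and
   are closed under y |-> y + a x^r; the coefficient of x^i y^j in F is F`_j i. *)
Definition laurent_poly (N : nat) F :=
  forall j, finite_set [set i | F`_j i != 0] /\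
    forall i, F`_j i != 0 -> exists k : int, i = k%:~R / N%:R.

Lemma xderiv_subproof f : `[< is_puiseux (fun i => ratr (i + 1) * f (i + 1)) >].
Proof.
have [a [b [b0 fa _ _]]] := common f f f.
apply/asboolP/(@exponents_in_puiseux _ (a%:~R - 1) b) => // e.
rewrite mulf_eq0 negb_or => /andP[_ /fa[k ek]]; exists k.
by rewrite -[e](addrK 1) ek addrAC.
Qed.
Definition xderiv f : A := Puiseux (xderiv_subproof f).

Definition dx F : {poly A} := map_poly xderiv F.

Definition bracket F G : {poly A} := dx F * G^`() - F^`() * dx G.

Definition deg_y F : nat := (size F).-1.

(* Always attained for f != 0; the degree of 0 is -oo. *)
Definition deg_x f : \bar rat :=
  if pselect (exists d : rat, f d != 0 /\ forall i, d < i -> f i = 0)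
    is left e then (projT1 (cid e))%:E else -oo%E.

Definition is_prime_degree F (p : rat) :=
  let c i := F`_(deg_y F - i) in
  (forall i, (i <= deg_y F)%N ->
     (deg_x (c i) <= deg_x (c 0%N) + (p * i%:R)%:E)%E) /\
  (exists i, (1 <= i <= deg_y F)%N /\
     deg_x (c i) = (deg_x (c 0%N) + (p * i%:R)%:E)%E).

Definition prime_degree F : \bar rat :=
  if F == lead_coef F *: 'X^(deg_y F) then -oo%E
  else if pselect (exists p, is_prime_degree F p) is left e
       then (projT1 (cid e))%:E else +oo%E.

Definition jacobi_pair F G :=
  [/\ exists2 c : K, c != 0 & bracket F G = (pmono c 0)%:P,
      prime_degree F \is a fin_num
    & (prime_degree G <= prime_degree F)%E].

(* The plane of exponents.  All supports are rational and finite, so the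
   Newton polygon is a rational polygon and is described in the rational plane. *)
Definition plane := convex_lmodType (rat^o * rat^o)%type.

Definition supp F : set plane :=
  [set u | exists (i : rat) (j : nat), u = (i, j%:R) /\ F`_j i != 0].

Definition newton_region F : set plane :=
  \bigcap_(C in [set C : set plane |
    convex_set C /\ supp F `|` [set (0, 0)] `<=` C]) C.

Definition is_vertex F (v : plane) :=
  newton_region F v /\
  forall (u w : plane) (t : {i01 rat}), newton_region F u -> newton_region F w ->
    0 < t%:num < 1 -> v = conv t u w -> u = v /\ w = v.

(* v and w are the top and the bottom of an edge having the whole polygon on
   its left; as v and w are extreme points of the region, the edge is exactly
   the intersection of the region with the line through v and w. *)
Definition is_right_edge F (v w : plane) :=
  [/\ is_vertex F v, is_vertex F w, w.2 < v.2 &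
    forall u, newton_region F u ->
      (u.1 - w.1) * (v.2 - w.2) <= (v.1 - w.1) * (u.2 - w.2)].

(* The slope is q / p > 0, or infinite when (p, q) = (0, 1). *)
Definition edge_slope (p q : nat) (v w : plane) :=
  [/\ (0 < p)%N, (0 < q)%N & (v.2 - w.2) / (v.1 - w.1) = q%:R / p%:R] \/
  [/\ p = 0%N, q = 1%N & v.1 = w.1].

Definition segment (v w : plane) : set plane :=
  [set u | exists t : {i01 rat}, u = conv t v w].

Lemma restrict_subproof (D : set rat) f :
  `[< is_puiseux (fun i => if i \in D then f i else 0) >].
Proof.
have /asboolP[a [b [b0 fa]]] := pcoefP f.
apply/asboolP; exists a, b; split=> // i.
by case: ifP => [_ /fa|]; rewrite ?eqxx.
Qed.
Definition restrict (D : set rat) f : A := Puiseux (restrict_subproof D f).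

(* The part of F supported on the segment between v and w. *)
Definition edge_part F (v w : plane) : {poly A} :=
  \poly_(j < size F) restrict [set i | segment v w (i, j%:R)] F`_j.

Definition one_irreducible_factor F :=
  exists P : {poly A}, [/\ irreducible_poly P, P %| F &
    forall Q : {poly A}, irreducible_poly Q -> Q %| F -> Q %= P].

Definition shift_y (a : K) (r : rat) F : {poly A} :=
  F \Po ('X + (pmono a r)%:P).

End JacobiPairs.

(* Main.v *)
(* Put r = p/q and give x^i y^j the weight i - r j.  The edge is then the part of
   highest weight D of F, and equals x^D f(x^r y) with f of degree dm; the edge
   of G similarly gives x^DG g(x^r y).  The slope hypothesis makes [F, G] vanish
   in the top weight, so D f g' = DG f' g and the multiplicities of f and g at
   each root are in the ratio m : n.  Shifting y by a x^-r, for a root a of f of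
   multiplicity mu, creates the vertex (D + r mu, mu), so it suffices to find a
   root with D < (1 - r) mu whenever f has at least two roots.

   For this, choose T in K[F, G] whose leading form does not commute with that
   of F, of least degree in G (such T exist because a leading form commuting
   with f is determined by its degree, and K[F, G] is too large for that).  With
   S = dT/dG and [F, T] = J S, the leading forms satisfy D f S' = s f' S and
   D f T' - t f' T = J S.  So f T / S has, at each root of f, a simple zero,
   and D <> (1 - r) mu there; comparing with the behaviour at infinity shows that
   f has at most (1 - r) (deg f) / D roots as soon as it has two; hence some
   multiplicity exceeds D / (1 - r). *)
Require Import Defs.
From HB Require Import structures.
From mathcomp Require Import all_boot all_order all_algebra.
From mathcomp Require Import boolp classical_sets reals ereal complex.
From mathcomp Require Import fsbigop interval_inference convex.
From mathcomp Require Import ring lra zify.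

Set Implicit Arguments.
Unset Strict Implicit.
Unset Printing Implicit Defensive.

Import Order.TTheory GRing.Theory Num.Theory.

Local Open Scope ring_scope.

#[local] Arguments pcoef : simpl never.

(** * Coefficients of products in the Puiseux field *)

Section PuiseuxCoefficients.
Variable K : fieldType.
Local Notation A := (puiseux K).
Implicit Types f g : A.

Lemma pcoefD f g i : (f + g) i = f i + g i. Proof. by []. Qed.

Lemma pcoef0 i : (0 : A) i = 0. Proof. by []. Qed.

Lemma pcoef_natmul f n i : (f *+ n) i = f i *+ n.
Proof. by elim: n => // n IH; rewrite !mulrS pcoefD IH. Qed.

Lemma pcoef_sum I (s : seq I) (P : pred I) (f : I -> A) i :
  (\sum_(k <- s | P k) f k) i = \sum_(k <- s | P k) f k i.
Proof. by elim/big_rec2: _ => // k x y _ <-. Qed.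

Lemma pcoef_mono (c : K) e i : pmono c e i = if i == e then c else 0.
Proof. by []. Qed.

(** One finite list of exponents serves all factors supported inside the supports of [f] and [g], so
    that several products can be compared term by term. *)
Lemma pcoef_mul f g k : exists s : seq rat, forall f' g' : A,
  (forall i, f' i != 0 -> f i != 0) -> (forall i, g' i != 0 -> g i != 0) ->
  (f' * g') k = \sum_(i <- s) f' i * g' (k - i).
Proof.
have [a [b [b0 fa ga _]]] := common f g f.
have bn0 : (b%:R : rat) != 0 by rewrite pnatr_eq0 -lt0n.
have inj : injective (fun j : nat => a%:~R - j%:R / b%:R : rat).
  by move=> i j /addrI/oppr_inj/(divIf bn0)/eqP; rewrite eqr_nat => /eqP.
(* If i = a - j/b and k - i = a - l/b, then j + l = (2a - k) b, which bounds j. *)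
pose M := Num.truncn ((a%:~R + a%:~R - k) * b%:R : rat).
exists [seq a%:~R - j%:R / b%:R | j <- iota 0 M.+1] => f' g' f'f g'g.
rewrite -[LHS]/(conv_coef f' g' k) /conv_coef.
rewrite (fsbigE [seq a%:~R - j%:R / b%:R | j <- iota 0 M.+1]) //; last 2 first.
- by rewrite (map_inj_uniq inj) iota_uniq.
- move=> i _ ni.
  have [->|/f'f/fa[j ij]] := eqVneq (f' i) 0; first by rewrite mul0r.
  have [->|/g'g/ga[l il]] := eqVneq (g' (k - i)) 0; first by rewrite mulr0.
  exfalso; move/negP: ni; apply; rewrite ij; apply/mapP; exists j => //.
  rewrite mem_iota/= add0n ltnS.
  have E : ((j + l)%:R : rat) = (a%:~R + a%:~R - k) * b%:R.
    rewrite -[k](subrK i) il ij natrD; by field.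
  by rewrite /M -E natrK leq_addr.
by apply: eq_bigl => i; rewrite in_setT.
Qed.

Lemma pmul_supp f g k : (f * g) k != 0 -> exists2 i, f i != 0 & g (k - i) != 0.
Proof.
move=> fg; apply: contrapT => h; move/eqP: fg; apply.
have [s ->//] := pcoef_mul f g k; rewrite big1// => i _.
have [->|fi] := eqVneq (f i) 0; first by rewrite mul0r.
have [->|gi] := eqVneq (g (k - i)) 0; first by rewrite mulr0.
by exfalso; apply: h; exists i.
Qed.

(** Exponents above [a] kill the first factor, and those below [a] push the second above [b]. *)
Lemma pcoef_mul_top a b f g : (forall i, a < i -> f i = 0) ->
  (forall i, b < i -> g i = 0) -> (f * g) (a + b) = f a * g b.
Proof.
move=> fa gb; rewrite -[LHS]/(conv_coef f g (a + b)) /conv_coef.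
rewrite (fsbigE [:: a])//; last first.
  move=> i _; rewrite inE; case: ltgtP => // ia _; last by rewrite fa// mul0r.
  by rewrite gb ?mulr0//; lra.
rewrite big_cons big_nil in_setT (addrC a) addrK; exact: addr0.
Qed.

Lemma pcoef_monoM (c : K) e f i : (pmono c e * f) i = c * f (i - e).
Proof.
rewrite -[LHS]/(conv_coef (pmono c e) f i) /conv_coef (fsbigE [:: e])//.
  by rewrite big_cons big_nil in_setT pcoef_mono eqxx; exact: addr0.
by move=> j _; rewrite inE pcoef_mono => /negPf ->; rewrite mul0r.
Qed.

Lemma pmonoM (c : K) e c' e' : pmono c e * pmono c' e' = pmono (c * c') (e + e').
Proof.
apply: puiseuxP => i; rewrite pcoef_monoM !pcoef_mono subr_eq addrC.
by case: eqP; rewrite ?mulr0.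
Qed.

Lemma puiseux_top f : f != 0 ->
  exists d : rat, (forall i, d < i -> f i = 0) /\ f d != 0.
Proof.
move=> /puiseux_lead[d [b [b0 fd f0]]]; exists d; split=> // i di.
have [//|/fd[k ik]] := eqVneq (f i) 0.
by move: di; rewrite ik ltNge gerBl divr_ge0.
Qed.

Definition pconst c : A := pmono c 0.

Fact pconst_zmod_morphism : zmod_morphism pconst.
Proof.
move=> c c'; apply: puiseuxP => i.
rewrite -[RHS]/(pconst c i - pconst c' i) /pconst !pcoef_mono.
by case: eqP; rewrite ?subrr.
Qed.

Fact pconst_monoid_morphism : monoid_morphism pconst.
Proof. by split=> // c c'; rewrite /pconst pmonoM addr0. Qed.

HB.instance Definition _ :=
  GRing.isZmodMorphism.Build K A pconst pconst_zmod_morphism.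
HB.instance Definition _ :=
  GRing.isMonoidMorphism.Build K A pconst pconst_monoid_morphism.

Lemma pcoef_constM c f i : (pconst c * f) i = c * f i.
Proof. by rewrite pcoef_monoM subr0. Qed.

End PuiseuxCoefficients.

(** * Weights, leading forms and their behaviour under the bracket *)

Section WeightedLeadingForms.
Variables (K : numFieldType) (r : rat).
Local Notation A := (puiseux K).
Implicit Types (f g : A) (T U V : {poly A}).

(** Multiplied by x, the derivation becomes the Euler operator, which scales the coefficient at i by
    i; in a product the two exponents add up to the total exponent. *)
Lemma xderivM f g : xderiv (f * g) = xderiv f * g + f * xderiv g.
Proof.
apply: puiseuxP => k; pose X : A := pmono 1 1.
have E h i : (X * h) (i + 1) = h i by rewrite pcoef_monoM mul1r addrK.
have D h i : (X * xderiv h) i = ratr i * h i.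
  by rewrite pcoef_monoM mul1r -[LHS]/(ratr (i - 1 + 1) * h (i - 1 + 1)) subrK.
have D0 h i : (X * xderiv h) i != 0 -> h i != 0.
  by rewrite D; apply: contra_neq => ->; rewrite mulr0.
rewrite pcoefD -[(xderiv f * g) k]E -[(f * xderiv g) k]E mulrA (mulrCA X f).
rewrite -[LHS]/(ratr (k + 1) * (f * g) (k + 1)).
have [s sE] := pcoef_mul f g (k + 1).
rewrite !sE//; try exact: D0.
rewrite mulr_sumr -big_split/=; apply: eq_bigr => i _.
by rewrite !D rmorphB/=; ring.
Qed.

Lemma xderivD f g : xderiv (f + g) = xderiv f + xderiv g.
Proof. by apply: puiseuxP => k; exact: mulrDr. Qed.

Lemma xderiv0 : xderiv (0 : A) = 0.
Proof. by apply: puiseuxP => k; exact: mulr0. Qed.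

Lemma coef_dx T j : (dx T)`_j = xderiv T`_j.
Proof. exact/coef_map_id0/xderiv0. Qed.

Lemma dxD T U : dx (T + U) = dx T + dx U.
Proof. by apply/polyP => j; rewrite coefD !coef_dx coefD xderivD. Qed.

Lemma dxM T U : dx (T * U) = dx T * U + T * dx U.
Proof.
apply/polyP => j; rewrite coefD coef_dx !coefM.
rewrite (big_morph _ xderivD xderiv0) -big_split/=; apply: eq_bigr => i _.
by rewrite xderivM !coef_dx.
Qed.

Lemma dx_const (c : K) : dx (pconst c)%:P = 0.
Proof.
apply/polyP => j; rewrite coef_dx coef0 coefC; case: eqP => _; last exact: xderiv0.
apply: puiseuxP => i; rewrite -[LHS]/(ratr (i + 1) * _ (i + 1)) /pconst pcoef_mono.
by case: eqP => [->|]; rewrite ?rmorph0 ?mul0r ?mulr0.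
Qed.

Lemma bracketD (F T U : {poly A}) : bracket F (T + U) = bracket F T + bracket F U.
Proof. by rewrite /bracket dxD derivD; ring. Qed.

Lemma bracketM (F T U : {poly A}) : bracket F (T * U) = bracket F T * U + T * bracket F U.
Proof. by rewrite /bracket dxM derivM; ring. Qed.

Lemma bracket_const (F : {poly A}) c : bracket F (pconst c)%:P = 0.
Proof. by rewrite /bracket dx_const derivC !mulr0 subrr. Qed.

Lemma bracket0 (F : {poly A}) : bracket F 0 = 0.
Proof. by rewrite -[in LHS](rmorph0 (@polyC A)) -(rmorph0 (@pconst K)) bracket_const. Qed.

Lemma bracketxx (F : {poly A}) : bracket F F = 0.
Proof. by rewrite /bracket [X in _ - X]mulrC subrr. Qed.

(* The monomial x^i y^j has weight i - r j; with z = x^r y, the part of weight t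
   of T is x^t * (wlead t T)(z). *)
Definition wle t T := forall j i, t + r * j%:R < i -> T`_j i = 0.

Definition wlead t T : {poly K} := \poly_(j < size T) T`_j (t + r * j%:R).

Lemma coef_wlead t T j : (wlead t T)`_j = T`_j (t + r * j%:R).
Proof. by rewrite coef_poly; case: ltnP => // Tj; rewrite nth_default. Qed.

Lemma wleP t T j i : wle t T -> T`_j i != 0 -> i <= t + r * j%:R.
Proof. by move=> tT; apply: contraNT; rewrite -ltNge => /tT ->. Qed.

Lemma wlead_lt s t T : s < t -> wle s T -> wlead t T = 0.
Proof.
by move=> st sT; apply/polyP => j; rewrite coef_wlead coef0 sT// ltrD2r.
Qed.

Lemma wlead_le s t T : wle s T -> wlead t T != 0 -> t <= s.
Proof. by move=> sT; apply: contraNT; rewrite -ltNge => /wlead_lt->. Qed.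

Lemma wlead_uniq s t T : wle s T -> wlead s T != 0 ->
  wle t T -> wlead t T != 0 -> s = t.
Proof.
by move=> sT s0 tT t0; apply: le_anti; rewrite (wlead_le tT s0) (wlead_le sT t0).
Qed.

Lemma wle0 t : wle t 0. Proof. by move=> j i _; rewrite coef0. Qed.

Lemma wleD t T U : wle t T -> wle t U -> wle t (T + U).
Proof. by move=> tT tU j i ti; rewrite coefD pcoefD tT// tU// addr0. Qed.

Lemma wleN t T : wle t T -> wle t (- T).
Proof. by move=> tT j i ti; rewrite coefN; apply/eqP; rewrite oppr_eq0 tT. Qed.

Lemma wlead0 t : wlead t 0 = 0.
Proof. by apply/polyP => j; rewrite coef_wlead !coef0. Qed.

Lemma wleadD t T U : wlead t (T + U) = wlead t T + wlead t U.
Proof. by apply/polyP => j; rewrite coefD !coef_wlead coefD. Qed.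

Lemma wleadN t T : wlead t (- T) = - wlead t T.
Proof. by apply/polyP => j; rewrite coefN !coef_wlead coefN. Qed.

Lemma wle_sum t n (T : 'I_n -> {poly A}) :
  (forall k, wle t (T k)) -> wle t (\sum_k T k).
Proof. by move=> tT; elim/big_ind: _ => //; [exact: wle0 | exact: wleD]. Qed.

Lemma wlead_sum t n (T : 'I_n -> {poly A}) :
  wlead t (\sum_k T k) = \sum_k wlead t (T k).
Proof. exact: (big_morph _ (wleadD t) (wlead0 t)). Qed.

Lemma wleM s t T U : wle s T -> wle t U -> wle (s + t) (T * U).
Proof.
move=> sT tU j i ij; rewrite coefM pcoef_sum big1// => k _.
apply: contra_ltP ij; move/eqP => /pmul_supp[l /(wleP sT) ls /(wleP tU)].
by rewrite natrB ?leq_ord//; lra.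
Qed.

Lemma wleadM s t T U : wle s T -> wle t U ->
  wlead (s + t) (T * U) = wlead s T * wlead t U.
Proof.
move=> sT tU; apply/polyP => j; rewrite coef_wlead !coefM pcoef_sum.
apply: eq_bigr => k _; rewrite !coef_wlead natrB ?leq_ord//.
rewrite -pcoef_mul_top; first by congr (pcoef _ _); ring.
  exact: sT.
by move=> i ij; apply: tU; rewrite natrB ?leq_ord.
Qed.

Lemma wleX t T n : wle t T -> wle (t * n%:R) (T ^+ n).
Proof.
move=> tT; elim: n => [|n IH].
  move=> [|j] i; rewrite expr0 coef1//= !mulr0 addr0.
  by rewrite pcoef_mono; case: eqP => // ->; rewrite ltxx.
by rewrite exprS -add1n natrD mulrDr mulr1; exact: wleM.
Qed.

Lemma wlead1 : wlead 0 1 = 1.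
Proof.
apply/polyP => -[|j]; rewrite coef_wlead !coef1//= mulr0 addr0.
by rewrite pcoef_mono eqxx.
Qed.

Lemma wleadX t T n : wle t T -> wlead (t * n%:R) (T ^+ n) = wlead t T ^+ n.
Proof.
move=> tT; elim: n => [|n IH]; first by rewrite mulr0 !expr0 wlead1.
by rewrite !exprS -add1n natrD mulrDr mulr1 wleadM// ?IH//; exact: wleX.
Qed.

Lemma wle_deriv t T : wle t T -> wle (t + r) T^`().
Proof.
move=> tT j i ti; rewrite coef_deriv pcoef_natmul tT ?mul0rn//.
by move: ti; rewrite -[j.+1]add1n natrD; lra.
Qed.

Lemma wlead_deriv t T : wlead (t + r) T^`() = (wlead t T)^`().
Proof.
apply/polyP => j; rewrite coef_wlead !coef_deriv coef_wlead.
rewrite pcoef_natmul.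
by congr (pcoef _ _ *+ _); rewrite -[j.+1]add1n natrD; ring.
Qed.

Lemma wle_dx t T : wle t T -> wle (t - 1) (dx T).
Proof.
move=> tT j i ti; rewrite coef_dx -[LHS]/(ratr (i + 1) * T`_j (i + 1)).
by rewrite tT ?mulr0//; lra.
Qed.

(** Differentiating x^(t + r j) brings down t + r j; the summand r j is r times the Euler operator X
    d/dX on the leading form. *)
Lemma wlead_dx t T : wlead (t - 1) (dx T) =
  ratr t *: wlead t T + ratr r *: ('X * (wlead t T)^`()).
Proof.
apply/polyP => j; rewrite coef_wlead coef_dx coefD !coefZ coefXM coef_wlead.
rewrite -[LHS]/(ratr (t - 1 + r * j%:R + 1) * T`_j (t - 1 + r * j%:R + 1)).
have -> : t - 1 + r * j%:R + 1 = t + r * j%:R by ring.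
rewrite rmorphD rmorphM/= ratr_nat mulrDl.
case: j => [|j]/=; first by rewrite !mulr0 mul0r.
by rewrite coef_deriv coef_wlead -[_ *+ j.+1]mulr_natl; ring.
Qed.

Lemma wle_bracket s t T U : wle s T -> wle t U ->
  wle (s + t + r - 1) (bracket T U).
Proof.
move=> sT tU; apply/wleD; last apply/wleN.
  have -> : s + t + r - 1 = (s - 1) + (t + r) by ring.
  by apply: wleM; [exact: wle_dx | exact: wle_deriv].
have -> : s + t + r - 1 = (s + r) + (t - 1) by ring.
by apply: wleM; [exact: wle_deriv | exact: wle_dx].
Qed.

(** The two terms with factor r X, each containing both derivatives, cancel; what remains is a
    weighted Wronskian of the leading forms. *)
Lemma wlead_bracket s t T U : wle s T -> wle t U ->
  wlead (s + t + r - 1) (bracket T U) =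
  ratr s *: (wlead s T * (wlead t U)^`()) -
  ratr t *: ((wlead s T)^`() * wlead t U).
Proof.
move=> sT tU; rewrite /bracket wleadD wleadN.
rewrite [X in wlead X (dx T * _)](_ : _ = (s - 1) + (t + r)); last by ring.
rewrite [X in wlead X (_ * dx U)](_ : _ = (s + r) + (t - 1)); last by ring.
rewrite !wleadM; try by [exact: wle_deriv | exact: wle_dx].
rewrite !wlead_dx !wlead_deriv -!mul_polyC; ring.
Qed.

(** The weight is the maximum of a - r n over the nonzero coefficients, where a is the top
    x-exponent of the coefficient of y^n. *)
Lemma wlead_exists T : T != 0 -> exists t, wle t T /\ wlead t T != 0.
Proof.
move=> T0; suff [t [tT [j [jT Tj]]]] : exists t,
    (forall j i, (j < size T)%N -> t + r * j%:R < i -> T`_j i = 0) /\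
    exists j, (j < size T)%N /\ T`_j (t + r * j%:R) != 0.
  exists t; split=> [k i ti|].
    by have [kT|Tk] := ltnP k (size T); [exact: tT | rewrite nth_default].
  by apply: contraNneq Tj => /polyP/(_ j); rewrite coef_wlead coef0 => ->.
have : exists2 j, (j < size T)%N & T`_j != 0.
  exists (size T).-1; last by rewrite -lead_coefE lead_coef_eq0.
  by rewrite prednK// size_poly_gt0.
elim: (size T) => [[]//|n IH] [j]; rewrite ltnS => jn Tj.
have [Tn|/puiseux_top[a [aT Ta]]] := eqVneq T`_n 0.
  have [|t [tT [k [kn Tk]]]] := IH.
    by exists j => //; rewrite ltn_neqAle jn andbT; apply: contraNneq Tj => ->; rewrite Tn.
  exists t; split; last by exists k; split=> //; exact: ltnW.
  by move=> l i; rewrite ltnS leq_eqVlt => /predU1P[->|ln]; [rewrite Tn | exact: tT].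
have [E|E] := pselect (exists2 j, (j < n)%N & T`_j != 0); last first.
  exists (a - r * n%:R); split=> [l i|]; last by exists n; rewrite ltnSn subrK.
  rewrite ltnS leq_eqVlt => /predU1P[->|ln]; first by rewrite subrK => /aT.
  have [->//|Tl] := eqVneq T`_l 0; by exfalso; apply: E; exists l.
have [t [tT [k [kn Tk]]]] := IH E.
exists (Order.max t (a - r * n%:R)); split=> [l i|].
  rewrite ltnS leq_eqVlt => /predU1P[->|ln tl].
    by rewrite maxEle; case: ifP => h ti; apply: aT; lra.
  by apply: tT => //; apply: le_lt_trans tl; rewrite lerD2r le_max lexx.
rewrite maxEle; case: ifP => _; first by exists n; rewrite ltnSn subrK.
by exists k; split=> //; exact: ltnW.
Qed.

Lemma wle_polyC t f : (forall i, t < i -> f i = 0) -> wle t f%:P.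
Proof. by move=> tf [|j] i; rewrite coefC//= mulr0 addr0 => /tf. Qed.

Lemma wlead_polyC t f : wlead t f%:P = (f t)%:P.
Proof. by apply/polyP => -[|j]; rewrite coef_wlead !coefC//= mulr0 addr0. Qed.

Lemma wlead_scale t (c : K) T : wlead t ((pconst c)%:P * T) = c *: wlead t T.
Proof.
by apply/polyP => j; rewrite coefZ !coef_wlead coefCM pcoef_constM.
Qed.

Lemma wle_scale t (c : K) T : wle t T -> wle t ((pconst c)%:P * T).
Proof. by move=> tT j i ti; rewrite coefCM pcoef_constM tT// mulr0. Qed.

Lemma wle_XaddC (a : K) : wle (- r) ('X + (pmono a (- r))%:P).
Proof.
apply: wleD; last first.
  by apply: wle_polyC => i; rewrite pcoef_mono; case: eqP => // ->; rewrite ltxx.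
move=> j i; rewrite coefX; case: eqP => // ->; rewrite mulr1 addNr.
by rewrite pcoef_mono; case: eqP => // ->; rewrite ltxx.
Qed.

Lemma wlead_XaddC (a : K) : wlead (- r) ('X + (pmono a (- r))%:P) = 'X + a%:P.
Proof.
rewrite wleadD wlead_polyC pcoef_mono eqxx; congr (_ + _).
apply/polyP => j; rewrite coef_wlead !coefX; case: eqP => // ->.
by rewrite mulr1 addNr pcoef_mono eqxx.
Qed.

(** Both y and x^(-r) have weight -r, so y + a x^(-r) is homogeneous; in the variable z = x^r y it
    becomes z + a. *)
Lemma wlead_shift t (a : K) T : wle t T ->
  wle t (shift_y a (- r) T) /\
  wlead t (shift_y a (- r) T) = wlead t T \Po ('X + a%:P).
Proof.
move=> tT; have tX := wle_XaddC a.
have E (j : nat) : t = (t + r * j%:R) + (- r) * j%:R by ring.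
have Tj (j : nat) : wle (t + r * j%:R) (T`_j)%:P by apply/wle_polyC => i; apply: tT.
rewrite /shift_y comp_polyE; split.
  apply: wle_sum => j; rewrite -mul_polyC [X in wle X](E j).
  by apply: wleM; [exact: Tj | exact: wleX].
rewrite wlead_sum [in RHS]/wlead poly_def raddf_sum/=; apply: eq_bigr => j _.
rewrite -mul_polyC [X in wlead X](E j) wleadM; [|exact: Tj|exact: wleX].
by rewrite wleadX// wlead_polyC wlead_XaddC mul_polyC comp_polyZ comp_Xn_poly.
Qed.

End WeightedLeadingForms.

(** * Orders of vanishing of weighted Wronskians, at roots and at infinity *)

Section RootMultiplicities.
Variable K : numClosedFieldType.
Implicit Types (p q f S T E : {poly K}) (a : K).

Lemma ratrM_eq0 (u : rat) (x : K) : (ratr u * x == 0) = (u == 0) || (x == 0).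
Proof. by rewrite (mulf_eq0 (ratr u)) fmorph_eq0. Qed.

Lemma mup_factor a p : p != 0 ->
  exists2 q, ~~ root q a & p = q * ('X - a%:P) ^+ (mup a p).
Proof.
move=> p0; have [m [q]] := multiplicity_XsubC p a; rewrite p0/= => qa pE.
by exists q => //; rewrite [in mup _ _]pE mupMr// mup_XsubCX eqxx.
Qed.

(** The extra factor X - a avoids the exponent m - 1, so the identity also covers m = 0. *)
Lemma deriv_XsubC_factor a q m : ('X - a%:P) * (q * ('X - a%:P) ^+ m)^`() =
  (q *+ m + ('X - a%:P) * q^`()) * ('X - a%:P) ^+ m.
Proof.
rewrite derivM deriv_exp derivXsubC mul1r.
by case: m => [|m]; rewrite ?exprS/=; ring.
Qed.

Lemma coefM_top p q m n : (size p <= m.+1)%N -> (size q <= n.+1)%N ->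
  (p * q)`_(m + n) = p`_m * q`_n.
Proof.
move=> pm qn; have mmn : (m < (m + n).+1)%N by rewrite ltnS leq_addr.
rewrite coefM (bigD1 (Ordinal mmn))//= addKn big1 ?addr0// => i.
rewrite -val_eqE/= neq_ltn => /orP[im|mi].
  by rewrite [q`_ _]nth_default ?mulr0// (leq_trans qn)//; lia.
by rewrite nth_default ?mul0r// (leq_trans pm).
Qed.

Lemma sum_count_mem (s t : seq K) : uniq s ->
  (\sum_(a <- s) count_mem a t)%N = count (mem s) t.
Proof.
move=> us; elim: t => [|x t IH] /=; first by rewrite big1.
rewrite big_split/= IH; congr (_ + _)%N.
rewrite -count_uniq_mem// -sum1_count [RHS]big_mkcond.
by apply: eq_bigr => a _ /=; rewrite eq_sym; case: eqP.
Qed.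

Lemma sum_mup_le (s : seq K) p : uniq s -> p != 0 ->
  (\sum_(a <- s) mup a p < size p)%N.
Proof.
move=> us p0; have [rs pE] := closed_field_poly_normal p.
have lp : lead_coef p != 0 by rewrite lead_coef_eq0.
rewrite (eq_bigr (fun a => count_mem a rs)) => [|a _].
  by rewrite sum_count_mem// pE size_scale// size_prod_XsubC ltnS count_size.
by rewrite pE -mul_polyC mupMr ?mu_prod_XsubC// rootC.
Qed.

Lemma sum_mup (s : seq K) p : uniq s -> p != 0 ->
  (forall a, root p a -> a \in s) -> (\sum_(a <- s) mup a p).+1 = size p.
Proof.
move=> us p0 ps; have [rs pE] := closed_field_poly_normal p.
have lp : lead_coef p != 0 by rewrite lead_coef_eq0.
rewrite (eq_bigr (fun a => count_mem a rs)) => [|a _].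
  rewrite sum_count_mem// pE size_scale// size_prod_XsubC.
  congr _.+1; apply/eqP; rewrite -all_count; apply/allP => a ars.
  by apply: ps; rewrite pE rootZ// root_prod_XsubC.
by rewrite pE -mul_polyC mupMr ?mu_prod_XsubC// rootC.
Qed.

Section Wronskian.
Variables (d t : rat) (f T : {poly K}).
Hypotheses (f0 : f != 0) (T0 : T != 0).
Let E := ratr d *: (f * T^`()) - ratr t *: (f^`() * T).

(** With f1, T1 the cofactors of the powers of X - a in f and T, the value of W at a is (d mup(T) -
    t mup(f)) f1(a) T1(a), and the last two factors are nonzero. *)
Lemma weighted_wronskian_at a : exists2 W,
  ('X - a%:P) * E = W * ('X - a%:P) ^+ (mup a f + mup a T) &
  root W a = (d * (mup a T)%:R == t * (mup a f)%:R).
Proof.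
have [f1 f1a fE] := mup_factor a f0; have [T1 T1a TE] := mup_factor a T0.
set L := 'X - a%:P : {poly K}; set m := mup a f; set n := mup a T.
exists (ratr d *: (f1 * (T1 *+ n + L * T1^`())) -
        ratr t *: ((f1 *+ m + L * f1^`()) * T1)).
  have fD := deriv_XsubC_factor a f1 m; have TD := deriv_XsubC_factor a T1 n.
  rewrite -/L -/m -/n in fD TD fE TE.
  rewrite /E mulrBr -!scalerAr (mulrCA L f) (mulrA L f^`()) [in L * T^`()]TE TD.
  rewrite [in L * f^`()]fE fD [in f * _]fE [in _ * T]TE -!mul_polyC exprD; ring.
rewrite /root !(hornerD, hornerN, hornerZ, hornerM, hornerMn, hornerX, hornerC).
rewrite subrr !mul0r !addr0.
rewrite (_ : _ - _ = ratr (d * n%:R - t * m%:R) * (f1.[a] * T1.[a])).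
  rewrite ratrM_eq0 subr_eq0 mulf_eq0 -/(root f1 a) -/(root T1 a).
  by rewrite (negPf f1a) (negPf T1a) !orbF.
by rewrite rmorphB !rmorphM/= !ratr_nat; ring.
Qed.

Lemma weighted_wronskian_eq0 a : E = 0 -> d * (mup a T)%:R = t * (mup a f)%:R.
Proof.
move=> E0; have [W] := weighted_wronskian_at a; rewrite E0 mulr0 => /esym/eqP.
rewrite mulf_eq0 expf_eq0 polyXsubC_eq0 andbF orbF => /eqP ->.
by rewrite root0 => /esym/eqP.
Qed.

Lemma mup_weighted_wronskian a : E != 0 ->
  (mup a f + mup a T <= (mup a E).+1 ?= iff
    (d * (mup a T)%:R != t * (mup a f)%:R)%R)%N.
Proof.
move=> E0; have [W WE <-] := weighted_wronskian_at a.
have W0 : W != 0.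
  apply: contraNneq E0 => W0; move/eqP: WE.
  by rewrite W0 mul0r mulf_eq0 polyXsubC_eq0.
have -> : (mup a E).+1 = (mup a W + (mup a f + mup a T))%N.
  have := congr1 (mup a) WE; rewrite !mupM ?polyXsubC_eq0 ?expf_eq0 ?polyXsubC_eq0 ?andbF//.
  by rewrite -[X in mup a X]expr1 !mup_XsubCX eqxx.
apply/leqifP; case: ifP => [Wa|/negbFE Wa].
  by rewrite (mupNroot Wa).
by rewrite -[ltnLHS]add0n ltn_add2r -XsubC_dvd// dvdp_XsubCl.
Qed.

Let M := (size f).-1.
Let e := (size T).-1.

(** The counterpart at infinity of the local computation. The factor X turns derivatives into Euler
    operators and avoids the index M + e - 1. *)
Lemma weighted_wronskian_top :
  ('X * E)`_(M + e) = ratr (d * e%:R - t * M%:R) * (f`_M * T`_e).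
Proof.
have sX p n : (size p <= n.+1)%N -> (size ('X * p^`())%R <= n.+1)%N.
  move=> pn; apply/leq_sizeP => -[|j] nj; rewrite coefXM//= coef_deriv.
  by rewrite nth_default ?mul0rn// (leq_trans pn).
have cX p n : ('X * p^`())`_n = p`_n *+ n.
  by rewrite coefXM; case: n => [|n]; rewrite ?mulr0n//= coef_deriv.
have sf : (size f <= M.+1)%N by rewrite leqSpred.
have sT : (size T <= e.+1)%N by rewrite leqSpred.
rewrite /E mulrBr -!scalerAr (mulrCA 'X f) (mulrA 'X) coefB !coefZ.
rewrite !coefM_top ?sX// !cX rmorphB !rmorphM/= !ratr_nat; ring.
Qed.

Lemma weighted_wronskian_eq0_deg : E = 0 -> d * e%:R = t * M%:R.
Proof.
move=> E0; have /esym/eqP := weighted_wronskian_top; rewrite E0 mulr0 coef0.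
by rewrite ratrM_eq0 subr_eq0 mulf_eq0 !lead_coef_eq0 (negPf f0) (negPf T0) !orbF => /eqP.
Qed.

Lemma size_weighted_wronskian : E != 0 ->
  (size E <= M + e)%N /\ (d * e%:R != t * M%:R -> size E = (M + e)%N).
Proof.
move=> E0; have sE : (size E <= M + e)%N.
  have sd p q : p != 0 -> q != 0 -> (size (p * q^`())%R <= (size p).-1 + (size q).-1)%N.
    move=> p0 q0; have [->|q'0] := eqVneq q^`() 0; first by rewrite mulr0 size_poly0.
    have := lt_size_deriv q0; have := size_mul_leq p q^`().
    by move: p0 q'0; rewrite -!size_poly_gt0; lia.
  rewrite /E (leq_trans (size_polyD _ _))// size_polyN geq_max.
  have le2 : (size (f^`() * T)%R <= M + e)%N by rewrite mulrC [(M + e)%N]addnC sd.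
  by rewrite !(leq_trans (size_scale_leq _ _))//; exact: sd.
split=> // dt; apply/eqP; rewrite eqn_leq sE leqNgt; apply/negP => Es.
have := weighted_wronskian_top; rewrite nth_default; last first.
  by rewrite mulrC size_mulX.
move/esym/eqP; rewrite ratrM_eq0 subr_eq0 (negPf dt) mulf_eq0.
by rewrite !lead_coef_eq0 (negPf f0) (negPf T0).
Qed.
End Wronskian.

(* At a root of f the order of vanishing of T is that of S - f, up to a shift
   by one, and the same comparison at infinity bounds the number of roots. *)
Lemma exists_heavy_root (d t s r : rat) (c : K) f S T a b :
  0 < d -> r < 1 -> s = d + t + r - 1 -> c != 0 -> S != 0 -> T != 0 -> f != 0 ->
  ratr d *: (f * S^`()) - ratr s *: (f^`() * S) = 0 ->
  ratr d *: (f * T^`()) - ratr t *: (f^`() * T) = c *: S ->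
  root f a -> root f b -> a != b ->
  exists2 x, root f x & d < (1 - r) * (mup x f)%:R.
Proof.
move=> d0 r1 sE c0 S0 T0 f0 fS fT fa fb ab; apply: contrapT => H.
have light x : root f x -> (1 - r) * (mup x f)%:R <= d.
  by move=> fx; rewrite leNgt; apply/negP => ?; apply: H; exists x.
have cS0 : c *: S != 0 by rewrite scaler_eq0 negb_or c0.
have sigma x : d * (mup x S)%:R = s * (mup x f)%:R by exact: weighted_wronskian_eq0.
have mS x : mup x (c *: S) = mup x S by rewrite -mul_polyC mupMr// rootC.
(* Write mu, tau, sigma for the multiplicities of f, T, S. If mu + tau = sigma + 1, multiplying by d
   gives d tau - t mu = d - (1 - r) mu, which is then nonzero. If instead d tau = t mu, then mu +
   tau <= sigma would give 0 <= (r - 1) mu, contradicting r < 1. *)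
have local x : root f x ->
    (mup x f + mup x T = (mup x S).+1)%N /\ (1 - r) * (mup x f)%:R < d.
  move=> fx; have mu0 : (0 < mup x f)%N by rewrite -XsubC_dvd// dvdp_XsubCl.
  have mu0' : 0 < (mup x f)%:R :> rat by rewrite ltr0n.
  have := @mup_weighted_wronskian d t f T f0 T0 x; rewrite fT mS => /(_ cS0).
  have := sigma x; rewrite sE => sx /leqifP; case: ifPn => [dt /eqP E|].
    split=> //; rewrite lt_neqAle light// andbT; apply: contraNneq dt => E'.
    have : (mup x f)%:R + (mup x T)%:R = (mup x S)%:R + 1 :> rat by rewrite -natrD E natr1.
    by move=> E2; apply/eqP; rewrite -E' in sx *; nra.
  rewrite negbK => /eqP dt; rewrite ltnS -(ler_nat rat) natrD => le.
  by exfalso; nra.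
have [rs fE] := closed_field_poly_normal f.
pose R := undup rs; have uR : uniq R by exact: undup_uniq.
have fR x : root f x = (x \in R).
  by rewrite fE rootZ ?lead_coef_eq0// root_prod_XsubC mem_undup.
clearbody R.
(* By [sigma] with d nonzero, S cannot vanish where f does not; hence the sum over [R] sees all
   roots of S. *)
have SR x : root S x -> x \in R.
  rewrite -dvdp_XsubCl XsubC_dvd// -fR; apply: contraLR => /mupNroot mf.
  by rewrite -eqn0Ngt -(pnatr_eq0 rat); have /eqP := sigma x; rewrite mf mulr0 mulf_eq0 gt_eqF.
have sumf : (\sum_(x <- R) mup x f).+1 = size f by apply: sum_mup => // x; rewrite fR.
have sumS := sum_mup uR S0 SR; have sumT := sum_mup_le uR T0.
have sumE : (\sum_(x <- R) mup x f + \sum_(x <- R) mup x T =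
    \sum_(x <- R) mup x S + size R)%N.
  rewrite -!big_split/= -sum1_size -big_split/=; apply: eq_big_seq => x xR.
  by rewrite addn1; have [|->] := local x; rewrite ?fR.
have sR : (2 <= size R)%N.
  rewrite (@uniq_leq_size _ [:: a; b])//= ?inE ?ab//.
  by move=> x; rewrite !inE => /orP[]/eqP->; rewrite -fR.
have [] := @size_weighted_wronskian d t f T f0 T0; rewrite fT//.
have -> : size (c *: S) = size S by exact: size_scale.
move=> _ top; have degS := weighted_wronskian_eq0_deg f0 S0 fS.
(* If the top coefficient of the Wronskian survives, deg S = deg f + deg T - 1, and [sumE] leaves
   room for at most one root of f. *)
have [dt|/top eT] := eqVneq (d * (size T).-1%:R) (t * (size f).-1%:R); last first.
  have le1 := sR; rewrite -(leq_add2l (\sum_(x <- R) mup x S)) -sumE in le1.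
  have le2 : (\sum_(x <- R) mup x f + \sum_(x <- R) mup x T <=
      (\sum_(x <- R) mup x S).+1)%N.
    move: eT; rewrite -sumf -sumS/= => ->.
    by rewrite leq_add2l -ltnS (leq_trans sumT)// leqSpred.
  by have := leq_trans le1 le2; rewrite addn2 ltnn.
(* Otherwise summing [local] gives (1 - r) deg f < d * size R, while d times [le], together with
   [degS] and [dt], gives the reverse inequality. *)
have lt : (1 - r) * (\sum_(x <- R) mup x f)%:R < d * (size R)%:R.
  rewrite natr_sum mulr_sumr -sum1_size natr_sum mulr_sumr.
  rewrite big_seq [ltRHS]big_seq; apply: ltr_sum => [|x xR].
    by apply/hasP; exists a; rewrite -fR.
  by rewrite mulr1; have [] := local x; rewrite ?fR.
have le : (\sum_(x <- R) mup x S)%:R + (size R)%:R <=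
    (\sum_(x <- R) mup x f)%:R + ((size T).-1)%:R :> rat.
  by rewrite -!natrD ler_nat -sumE leq_add2l -ltnS (leq_trans sumT)// leqSpred.
move: degS dt; rewrite -sumf -sumS/= sE => degS dt; nra.
Qed.

End RootMultiplicities.

(** * The algebra K[F, G] and the choice of T *)

Section ElementsOfTheJacobianAlgebra.
Variable K : numClosedFieldType.
Local Notation A := (puiseux K).
Variables (F G : {poly A}).

Definition eval1 : {poly K} -> {poly A} := comp_poly F \o map_poly (@pconst K).

(** The inner variable stands for F and the outer one for G, so the formal derivative in the outer
    variable plays the role of d/dG. *)
Definition eval2 : {poly {poly K}} -> {poly A} :=
  horner_eval G \o map_poly eval1.

HB.instance Definition _ := GRing.RMorphism.on eval1.
HB.instance Definition _ := GRing.RMorphism.on eval2.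

Lemma eval2X : eval2 'X = G.
Proof. by rewrite /eval2/= /horner_eval map_polyX hornerX. Qed.

Lemma eval1_cons p c : eval1 (p * 'X + c%:P) = eval1 p * F + (pconst c)%:P.
Proof. by rewrite rmorphD rmorphM/= /eval1/= map_polyX comp_polyX map_polyC comp_polyC. Qed.

Lemma eval2_cons P p : eval2 (P * 'X + p%:P) = eval2 P * G + eval1 p.
Proof.
by rewrite rmorphD rmorphM/= eval2X {2}/eval2/= /horner_eval map_polyC hornerC.
Qed.

Lemma eval1_eq0 p : (1 < size F)%N -> (eval1 p == 0) = (p == 0).
Proof. by move=> F1; rewrite /eval1/= comp_poly_eq0; [exact: map_poly_eq0|exact: F1]. Qed.

Lemma bracket_eval1 p : bracket F (eval1 p) = 0.
Proof.
elim/poly_ind: p => [|p c IH]; first by rewrite rmorph0 bracket0.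
by rewrite eval1_cons bracketD bracketM IH bracketxx bracket_const mul0r mulr0 !addr0.
Qed.

(** The map [F, -] is a derivation that kills F and the constants and sends G to J, hence it is J
    d/dG. *)
Lemma bracket_eval2 J P : bracket F G = (pconst J)%:P ->
  bracket F (eval2 P) = (pconst J)%:P * eval2 P^`().
Proof.
move=> FG; elim/poly_ind: P => [|P p IH].
  by rewrite deriv0 !rmorph0 mulr0 bracket0.
rewrite eval2_cons bracketD bracketM bracket_eval1 IH FG derivD derivM derivC derivX.
by rewrite !addr0 mulr1 rmorphD rmorphM/= eval2X; ring.
Qed.

Lemma eval2_monomial c i j :
  eval2 ((c *: 'X^i)%:P * 'X^j) = (pconst c)%:P * (F ^+ i * G ^+ j).
Proof.
rewrite rmorphM/= {2}/eval2/= /horner_eval map_polyXn hornerXn mulrA; congr (_ * _).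
rewrite /eval2/= /horner_eval map_polyC hornerC /= /eval1/= -mul_polyC rmorphM/=.
by rewrite map_polyC map_polyXn comp_polyM comp_polyC comp_Xn_poly.
Qed.

(* There are about k^2 monomials in F, G of degree < k in each variable, but
   only O(k) conditions. *)
Lemma exists_eval2_vanishing (e : nat -> rat) :
  exists2 P, P != 0 & forall j, (eval2 P)`_j (e j) = 0.
Proof.
(* There are k^2 monomials and L = k (k - 2) + 1 < k^2 conditions, where L bounds the size of every
   combination; so the rows of [B] are dependent. *)
pose k := (size F + size G).+2; pose L := (k * (size F + size G)).+1.
pose B : 'M[K]_(k * k, L) := \matrix_(l, j) (F ^+ (l %% k) * G ^+ (l %/ k))`_j (e j).
have [u uB u0] : exists2 u : 'rV_(k * k), u *m B = 0 & u != 0.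
  have : kermx B != 0.
    rewrite -mxrank_eq0 mxrank_ker -lt0n subn_gt0 (leq_ltn_trans (rank_leq_col B))//.
    by rewrite /L /k; nia.
  by move=> /rowV0Pn[u /sub_kermxP uB u0]; exists u.
pose P := \sum_(l < k * k) (u 0 l *: 'X^(l %% k))%:P * 'X^(l %/ k) : {poly {poly K}}.
have PE : eval2 P = \sum_(l < k * k) (pconst (u 0 l))%:P * (F ^+ (l %% k) * G ^+ (l %/ k)).
  by rewrite rmorph_sum; apply: eq_bigr => l _; exact: eval2_monomial.
exists P => [|j].
  apply: contraNneq u0 => P0; apply/eqP/rowP => l; rewrite mxE.
  have := congr1 (fun Q : {poly {poly K}} => Q`_(l %/ k)`_(l %% k)) P0.
  rewrite !coef0 /P !coef_sum (bigD1 l)//= big1 => [|l' l'l].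
    by rewrite !addr0 coefCM coefXn eqxx mulr1 coefZ coefXn eqxx mulr1.
  rewrite coefCM coefXn; case: eqP => [q|_]; last by rewrite mulr0 coef0.
  rewrite mulr1 coefZ coefXn; case: eqP => [m|_]; last by rewrite mulr0.
  by case/eqP: l'l; apply: val_inj; rewrite /= (divn_eq l k) (divn_eq l' k) q m.
have [jL|Lj] := ltnP j L.
  have := congr1 (fun v : 'rV_L => v 0 (Ordinal jL)) uB; rewrite !mxE => <-.
  rewrite PE coef_sum pcoef_sum; apply: eq_bigr => l _.
  by rewrite coefCM pcoef_constM mxE.
rewrite nth_default// (leq_trans _ Lj)// PE.
apply: leq_trans (size_sum _ _ _) _; apply/bigmax_leqP => l _.
have sX (T : {poly A}) i : (i <= k)%N -> (size (T ^+ i) <= (k * size T).+1)%N.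
  move=> ik; apply: leq_trans (size_poly_exp_leq _ _) _.
  by rewrite ltnS mulnC leq_mul// leq_pred.
have lk : (l < k * k)%N by exact: ltn_ord.
have s1 : (size (F ^+ (l %% k)) <= (k * size F).+1)%N by rewrite sX// ltnW ?ltn_mod.
have s2 : (size (G ^+ (l %/ k)) <= (k * size G).+1)%N by rewrite sX// ltnW ?ltn_divLR.
rewrite mul_polyC; apply: leq_trans (size_scale_leq _ _) _.
apply: leq_trans (size_polyMleq _ _) _; rewrite -subn1 leq_subLR.
by apply: leq_trans (leq_add s1 s2) _; rewrite /L mulnDr addnS addSn add1n.
Qed.

Lemma deriv_eq0_polyC (P : {poly {poly K}}) : P^`() = 0 -> P = (P`_0)%:P.
Proof.
move=> P0; apply: size1_polyC; apply/leq_sizeP => -[//|j] _.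
apply/polyP => i; have /polyP/(_ j)/polyP/(_ i)/eqP := P0.
by rewrite coef_deriv coefMn !coef0 mulrn_eq0 => /eqP.
Qed.

(* T is taken of least degree in G among the elements whose leading form does not
   commute with f, so the leading form S of dT/dG does. *)
Lemma exists_noncommuting_leading_form (r d : rat) (J : K) :
  let f := wlead r d F in
  bracket F G = (pconst J)%:P -> J != 0 -> wle r d F -> (1 < size f)%N ->
  exists s t S T, [/\ s = d + t + r - 1, S != 0, T != 0,
    ratr d *: (f * S^`()) - ratr s *: (f^`() * S) = 0 &
    ratr d *: (f * T^`()) - ratr t *: (f^`() * T) = J *: S].
Proof.
move=> f FG J0 dF f1; have f0 : f != 0 by rewrite -size_poly_gt0 ltnW.
pose W (t : rat) (T : {poly K}) : {poly K} := ratr d *: (f * T^`()) - ratr t *: (f^`() * T).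
(* The condition is vacuous when [eval2 P = 0]; where the descent stops, [eval2 P] is shown to be
   nonzero. *)
pose bad (P : {poly {poly K}}) := P != 0 /\ forall t : rat, wle r t (eval2 P) ->
  wlead r t (eval2 P) != 0 -> W t (wlead r t (eval2 P)) != 0.
have WE (t : rat) T : wle r t T -> wlead r (d + t + r - 1) (bracket F T) = W t (wlead r t T).
  exact: wlead_bracket.
suff descent n (P : {poly {poly K}}) : (size P <= n)%N -> bad P -> exists s t S T,
    [/\ s = d + t + r - 1, S != 0, T != 0, W s S = 0 & W t T = J *: S].
  pose M := (size f).-1.
  (* A leading form of weight t and degree k that commutes with f satisfies d k = t M, so its top
     monomial has x-exponent t + r k = (d + r M) k / M. Killing these coefficients excludes such
     forms. *)
  have [P P0 Pe] := exists_eval2_vanishing (fun j => (d + r * M%:R) * j%:R / M%:R).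
  apply: (descent _ P (leqnn _)); split=> // t tT T0; apply/eqP => W0.
  have := weighted_wronskian_eq0_deg f0 T0 W0.
  set k := (size _).-1 => de; have := Pe k; apply/eqP.
  rewrite (_ : _ / _ = t + r * k%:R); first by rewrite -coef_wlead -lead_coefE lead_coef_eq0.
  have M0 : M%:R != 0 :> rat by rewrite pnatr_eq0 -lt0n /M; lia.
  by apply: (mulIf M0); rewrite mulfVK// mulrDl -/M in de *; rewrite de; ring.
elim: n P => [|n IH] P.
  by rewrite leqn0 size_poly_eq0 => /eqP -> []; rewrite eqxx.
(* When P is constant in the outer variable, [eval2 P] is a nonzero polynomial in F and commutes
   with F, against [bad]. *)
move=> Pn [P0 badP]; have [P'0|P'0] := eqVneq P^`() 0.
  have T0 : eval2 P != 0.
    rewrite (deriv_eq0_polyC P'0) /eval2/= /horner_eval map_polyC hornerC/=.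
    rewrite eval1_eq0.
      by apply: contraNneq P0 => P00; rewrite (deriv_eq0_polyC P'0) P00.
    by rewrite (leq_trans f1)// /f /wlead size_poly.
  have [t [tT Tt]] := wlead_exists r T0.
  have := badP t tT Tt; rewrite -WE// (bracket_eval2 _ FG) P'0 rmorph0 mulr0.
  by rewrite wlead0 eqxx.
have [//|/not_andP[//|]] := pselect (bad P^`()).
  by apply: IH; rewrite -ltnS (leq_trans (lt_size_deriv P0)).
move=> /existsNP[s /not_implyP[sS /not_implyP[S0 /negP/negbNE/eqP Ws]]].
have FT := bracket_eval2 P FG.
have T0 : eval2 P != 0.
  apply: contraNneq S0 => T0; move/esym/eqP: FT; rewrite T0.
  rewrite bracket0 mulf_eq0 polyC_eq0 fmorph_eq0 (negPf J0) => /eqP ->.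
  by rewrite wlead0.
have [t [tT Tt]] := wlead_exists r T0; have Wt := badP t tT Tt.
(* Both sides are the weight of [F, T] = J dT/dG: its leading form is nonzero at either of them. *)
have E : s = d + t + r - 1.
  apply: (@wlead_uniq _ r _ _ (bracket F (eval2 P))).
  - by rewrite FT; exact: wle_scale.
  - by rewrite FT wlead_scale scaler_eq0 negb_or J0.
  - exact: wle_bracket.
  - by rewrite WE.
exists s, t, (wlead r s (eval2 P^`())), (wlead r t (eval2 P)); split=> //.
by rewrite -WE// FT -E wlead_scale.
Qed.

End ElementsOfTheJacobianAlgebra.

(** * Vertices and edges of the Newton polygon through leading forms *)

Section NewtonPolygons.
Variable K : numClosedFieldType.
Local Notation A := (puiseux K).
Variable r : rat.
Implicit Types (F : {poly A}) (u v w : plane) (t : {i01 rat}).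

Lemma conv_fst u v t :
  (conv t u v : plane).1 = t%:num * u.1 + (1 - t%:num) * v.1.
Proof. by []. Qed.

Lemma conv_snd u v t :
  (conv t u v : plane).2 = t%:num * u.2 + (1 - t%:num) * v.2.
Proof. by []. Qed.

Lemma plane_eq u v : u.1 = v.1 -> u.2 = v.2 -> u = v.
Proof. by case: u v => [? ?] [? ?] /= -> ->. Qed.

Lemma newton_region_min F (C : set plane) u : convex_set C ->
  (forall i (j : nat), F`_j i != 0 -> C (i, j%:R)) -> C (0, 0) ->
  newton_region F u -> C u.
Proof.
move=> cC sC C0 Fu; apply: (Fu C); split=> // _ [[i [j [-> /sC]]]|->] //.
Qed.

Lemma newton_region_supp F i (j : nat) : F`_j i != 0 -> newton_region F (i, j%:R).
Proof. by move=> Fji C [_]; apply; left; exists i, j. Qed.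

(** If the form vanished, the support would lie in an open half-plane, which also contains the
    origin since D > 0; the whole region would then miss the line through v. *)
Lemma newton_region_wle F D v : 0 < D -> newton_region F v ->
  v.1 = D + r * v.2 -> wle r D F -> wlead r D F != 0.
Proof.
move=> D0 Fv vD DF; apply/eqP => F0.
suff : [set u : plane | u.1 < D + r * u.2]%classic v by rewrite /= vD ltxx.
apply: (newton_region_min _ _ _ Fv).
- apply/convex_setW => x y; rewrite !inE /mkset => xD yD t t0 t1.
  by rewrite inE /mkset conv_fst conv_snd; nra.
- move=> i j Fji /=; rewrite lt_neqAle (wleP DF Fji) andbT; apply: contraNneq Fji => ->.
  by rewrite -coef_wlead F0 coef0.
- by rewrite /= mulr0 addr0.
Qed.

Lemma is_vertex_wlead F D k : 0 < D -> wle r D F -> (wlead r D F)`_k != 0 ->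
  (forall j, (j < k)%N -> (wlead r D F)`_j = 0) ->
  is_vertex F (D + r * k%:R, k%:R).
Proof.
move=> D0 DF Fk Flow; split=> [|u w t].
  by apply: newton_region_supp; rewrite -coef_wlead.
(* [C] is the half-plane of weight at most D without the boundary points below height k. It is
   convex, and D > 0 puts the origin inside. A boundary point splits only into boundary points, here
   both of height at least k. *)
pose C := [set u : plane | u.1 <= D + r * u.2 /\
  (u.1 = D + r * u.2 -> k%:R <= u.2)]%classic.
have FC x : newton_region F x -> C x.
  apply: newton_region_min.
  - apply/convex_setW => {}u {}w; rewrite !inE => -[u1 u2] [w1 w2] {}t t0 t1.
    rewrite inE /C /mkset conv_fst conv_snd.
    split; first by nra.
    move=> E; have Eu : u.1 = D + r * u.2 by nra.
    have Ew : w.1 = D + r * w.2 by nra.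
    by have := u2 Eu; have := w2 Ew; nra.
  - move=> i j Fji /=; split=> [|ij]; first exact: wleP Fji.
    rewrite ler_nat leqNgt; apply: contra Fji => /Flow.
    by rewrite coef_wlead -ij => ->.
  - split=> /=; rewrite mulr0 addr0; first exact: ltW.
    by move=> E; rewrite -E ltxx in D0.
move=> /FC[u1 u2] /FC[w1 w2] /andP[t0 t1] vE.
have := congr1 fst vE; have := congr1 snd vE; rewrite conv_fst conv_snd /= => E2 E1.
rewrite [in LHS]E2 in E1.
have Eu : u.1 = D + r * u.2 by nra.
have Ew : w.1 = D + r * w.2 by nra.
have {}u2 := u2 Eu; have {}w2 := w2 Ew.
have u2k : u.2 = k%:R by nra.
have w2k : w.2 = k%:R by nra.
by split; apply: plane_eq; rewrite /= ?Eu ?Ew ?u2k ?w2k.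
Qed.

Lemma conv_between u w (y : rat) : w.2 < y < u.2 -> exists2 t : {i01 rat},
  0 < t%:num < 1 & y = t%:num * u.2 + (1 - t%:num) * w.2.
Proof.
move=> /andP[wy yu]; have wu : 0 < u.2 - w.2 by lra.
have t0 : 0 <= (y - w.2) / (u.2 - w.2) by rewrite divr_ge0//; lra.
have t1 : (y - w.2) / (u.2 - w.2) <= 1 by rewrite ler_pdivrMr//; lra.
exists (Itv01 t0 t1); rewrite /=; last by field; rewrite gt_eqF.
apply/andP; split; first by rewrite divr_gt0//; lra.
by rewrite ltr_pdivrMr//; lra.
Qed.

Lemma vertex_not_between F D u v w : is_vertex F v ->
  newton_region F u -> newton_region F w ->
  u.1 = D + r * u.2 -> v.1 = D + r * v.2 -> w.1 = D + r * w.2 ->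
  ~~ (w.2 < v.2 < u.2).
Proof.
move=> [_ vmin] Fu Fw uD vD wD; apply/negP => wvu.
have [t t01 vt] := conv_between wvu.
have [|uv _] := vmin u w t Fu Fw t01.
  apply: plane_eq; last by rewrite conv_snd.
  by rewrite conv_fst uD wD vD vt; ring.
by case/andP: wvu => _; rewrite uv ltxx.
Qed.

Lemma right_edge_wle F p q v w : r = p%:R / q%:R ->
  is_right_edge F v w -> edge_slope p q v w ->
  w.1 = (v.1 - r * v.2) + r * w.2 /\ wle r (v.1 - r * v.2) F.
Proof.
move=> rE [Fv Fw wv edge] slope; have wv0 : 0 < v.2 - w.2 by rewrite subr_gt0.
have vw : v.1 - w.1 = r * (v.2 - w.2).
  case: slope => [[p0 q0 E]|[p0 _ ->]]; last by rewrite rE p0 !mul0r subrr.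
  have p0' : p%:R != 0 :> rat by rewrite pnatr_eq0 -lt0n.
  have q0' : q%:R != 0 :> rat by rewrite pnatr_eq0 -lt0n.
  (* A zero denominator would make the quotient 0 by convention, whereas q / p is nonzero. *)
  have vw0 : v.1 - w.1 != 0.
    apply: contraTneq isT => vw0; move: E; rewrite vw0 invr0 mulr0 => /esym/eqP.
    by rewrite mulf_eq0 invr_eq0 (negPf p0') (negPf q0').
  by rewrite -[v.2 - w.2](divfK vw0) E rE; field; rewrite p0'.
split=> [|j i ij]; first by lra.
apply: contra_ltP ij => /eqP/newton_region_supp/edge /=.
by rewrite vw mulrAC ler_pM2r//; lra.
Qed.

(** A support point of weight D beyond v or w would place that vertex strictly inside a segment of
    the region, so the edge carries the entire leading form. *)
Lemma coef_edge_part F D v w : is_vertex F v -> is_vertex F w -> w.2 < v.2 ->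
  v.1 = D + r * v.2 -> w.1 = D + r * w.2 -> wle r D F ->
  forall j, (edge_part F v w)`_j = pmono (wlead r D F)`_j (D + r * j%:R).
Proof.
move=> Fv Fw wv vD wD DF j; apply: puiseuxP => i; rewrite pcoef_mono coef_wlead.
rewrite coef_poly; case: ifP => [_|]; last first.
  by move=> /negbT; rewrite -leqNgt => Fj; rewrite nth_default//; case: ifP.
rewrite -[LHS]/(if i \in [set i | segment v w (i, j%:R)]%classic then F`_j i else 0).
have [Fji|Fji] := eqVneq (F`_j i) 0.
  by rewrite Fji; case: ifP; case: eqP => // <-; rewrite Fji.
have Fu := newton_region_supp Fji.
have [iD|iD] := eqVneq i (D + r * j%:R); last first.
  rewrite ifF//; apply/negbTE/negP; rewrite inE => -[t E].
  have := congr1 fst E; have := congr1 snd E.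
  rewrite conv_fst conv_snd /= vD wD => E2 E1; move/eqP: iD; apply.
  by rewrite E1 E2; ring.
rewrite -iD ifT// inE.
have jv : j%:R <= v.2.
  have := vertex_not_between Fv Fu (proj1 Fw) iD vD wD.
  by rewrite wv/= -leNgt.
have jw : w.2 <= j%:R.
  have := vertex_not_between Fw (proj1 Fv) Fu vD wD iD.
  by rewrite wv/= andbT -leNgt.
have wv0 : 0 < v.2 - w.2 by lra.
have t0 : 0 <= (j%:R - w.2) / (v.2 - w.2) by rewrite divr_ge0//; lra.
have t1 : (j%:R - w.2) / (v.2 - w.2) <= 1 by rewrite ler_pdivrMr//; lra.
exists (Itv01 t0 t1); apply: plane_eq; rewrite ?conv_fst ?conv_snd /= ?iD ?vD ?wD.
  by field; rewrite gt_eqF.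
by field; rewrite gt_eqF.
Qed.

Lemma size_wlead_vertex F D w (k : nat) :
  is_vertex F (D + r * k%:R, k%:R) -> newton_region F w ->
  w.2 < k%:R -> w.1 = D + r * w.2 -> (size (wlead r D F) <= k.+1)%N.
Proof.
move=> Fv Fw wk wD; apply/leq_sizeP => j kj; apply: contraTeq isT => Fj.
have Fu : newton_region F (D + r * j%:R, j%:R).
  by apply: newton_region_supp; rewrite -coef_wlead.
have := vertex_not_between Fv Fu Fw erefl erefl wD.
by rewrite wk/= ltr_nat kj.
Qed.

Definition whomogeneous D F := forall j i, F`_j i != 0 -> i = D + r * j%:R.

Lemma whomogeneous_coef D F j : whomogeneous D F ->
  F`_j = pmono (wlead r D F)`_j (D + r * j%:R).
Proof.
move=> DF; apply: puiseuxP => i; rewrite pcoef_mono coef_wlead.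
by case: eqP => [->//|iD]; apply: contra_not_eq iD; exact: DF.
Qed.

Lemma whomogeneousM s (t : rat) F (G : {poly A}) :
  whomogeneous s F -> whomogeneous t G -> whomogeneous (s + t) (F * G).
Proof.
move=> sF tG j i; rewrite coefM pcoef_sum => FG; apply: contra_neq_eq FG => ij.
rewrite big1// => k _; apply: contra_neq_eq ij => /pmul_supp[l /sF lE /tG].
by rewrite natrB ?leq_ord//; lra.
Qed.

Lemma whomogeneousX (t : rat) F n : whomogeneous t F -> whomogeneous (t * n%:R) (F ^+ n).
Proof.
move=> tF; elim: n => [|n IH].
  move=> [|j] i; rewrite expr0 coef1/= ?pcoef0 ?eqxx// pcoef_mono !mulr0 addr0.
  by case: (i =P 0) => // _; rewrite eqxx.
by rewrite exprS -add1n natrD mulrDr mulr1; exact: whomogeneousM.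
Qed.

Lemma whomogeneous_wle (t : rat) F : whomogeneous t F -> wle r t F.
Proof. by move=> tF j i ti; apply: contraTeq ti => /tF ->; rewrite ltxx. Qed.

Lemma whomogeneous_polyC (c : K) (t : rat) : whomogeneous t (pmono c t)%:P.
Proof.
move=> [|j] i; rewrite coefC/= ?pcoef0 ?eqxx// pcoef_mono mulr0 addr0.
by case: (i =P t) => // _; rewrite eqxx.
Qed.

Lemma whomogeneous_XaddC (c : K) : whomogeneous (- r) ('X + (pmono c (- r))%:P).
Proof.
move=> [|[|j]] i; rewrite coefD coefX coefC/= ?add0r ?addr0 ?pcoef0 ?eqxx//.
  by rewrite pcoef_mono mulr0 addr0; case: (i =P _) => // _; rewrite eqxx.
by rewrite pcoef_mono mulr1 addNr; case: (i =P _) => // _; rewrite eqxx.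
Qed.

(** A homogeneous polynomial is determined by its leading form, so the edge part is a unit times the
    k-th power of the linear polynomial y - a x^(-r). *)
Lemma one_irreducible_factor_edge_part F D v w (c a : K) k :
  is_vertex F v -> is_vertex F w -> w.2 < v.2 ->
  v.1 = D + r * v.2 -> w.1 = D + r * w.2 -> wle r D F ->
  wlead r D F = c *: ('X - a%:P) ^+ k -> c != 0 -> (0 < k)%N ->
  one_irreducible_factor (edge_part F v w).
Proof.
move=> Fv Fw wv vD wD DF fE c0 k0; pose P : {poly A} := 'X + (pmono (- a) (- r))%:P.
have hP : whomogeneous (- r) P by exact: whomogeneous_XaddC.
pose u : A := pmono c (D + r * k%:R).
have hU : whomogeneous D (u%:P * P ^+ k).
  have E : D = (D + r * k%:R) + (- r) * k%:R by ring.
  rewrite [X in whomogeneous X](E); apply: whomogeneousM; last exact: whomogeneousX.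
  exact: whomogeneous_polyC.
have UE : wlead r D (u%:P * P ^+ k) = wlead r D F.
  have E : D = (D + r * k%:R) + (- r) * k%:R by ring.
  rewrite [X in wlead r X (_ * _)](E) wleadM.
  - rewrite wlead_polyC pcoef_mono eqxx wleadX; last exact: whomogeneous_wle.
    by rewrite wlead_XaddC fE mul_polyC polyCN.
  - exact/whomogeneous_wle/whomogeneous_polyC.
  - exact/whomogeneous_wle/whomogeneousX.
have -> : edge_part F v w = u%:P * P ^+ k.
  apply/polyP => j; rewrite (coef_edge_part Fv Fw wv vD wD DF).
  by rewrite (whomogeneous_coef _ hU) UE.
have irrP : irreducible_poly P by exact: irredp_XaddC.
have u0 : u != 0.
  apply: contraNneq c0 => /(congr1 (fun f : A => f (D + r * k%:R))).
  by rewrite /u pcoef_mono eqxx => ->.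
exists P; split=> // [|Q irrQ QP].
  by rewrite mul_polyC dvdpZr// -(prednK k0) exprS dvdp_mulr.
rewrite mul_polyC dvdpZr// in QP.
have : ~~ coprimep Q P.
  apply/negP => /(coprimep_expr k) QPk; have := Gauss_dvdpr 1 QPk.
  by rewrite mulr1 QP dvdp1 => /esym/eqP Q1; move: irrQ.1; rewrite Q1 ltnn.
rewrite {1}/P -[pmono _ _]opprK polyCN coprimep_XsubC negbK -dvdp_XsubCl => PQ.
rewrite eqp_sym /P -[pmono _ _]opprK polyCN; apply: irrQ.2 => //.
by rewrite size_XsubC.
Qed.

End NewtonPolygons.

(** * Translating a root to the origin, and the proof of the theorem *)

Lemma coef_comp_XaddC_mup (K : numClosedFieldType) (f : {poly K}) a : f != 0 ->
  (f \Po ('X + a%:P))`_(mup a f) != 0 /\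
  forall j, (j < mup a f)%N -> (f \Po ('X + a%:P))`_j = 0.
Proof.
move=> f0; have [f1 f1a fE] := mup_factor a f0; set k := mup a f in fE *.
have -> : f \Po ('X + a%:P) = (f1 \Po ('X + a%:P)) * 'X^k.
  rewrite {1}fE comp_polyM rmorphXn/= comp_polyB comp_polyX comp_polyC.
  by rewrite addrK.
split=> [|j jk]; rewrite coefMXn ?jk// ltnn subnn -horner_coef0 horner_comp.
by rewrite !hornerE.
Qed.

Theorem theorem3p30 (R : realType) (N : nat) (F G : {poly puiseux R[i]})
  (m n : nat) (m0 : rat) (p q : nat) (dm0 dn0 : rat) (dm dn : nat)
  (wF wG : plane)
  (hN : (0 < N)%N) (hF : laurent_poly N F) (hG : laurent_poly N G)
  (hJ : jacobi_pair F G)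
  (hm : deg_y F = m) (hn : deg_y G = n)
  (hm0 : deg_x (lead_coef F) = m0%:E)
  (hm0m : 0 < m0 < m%:R)
  (hp : (prime_degree F <= 0)%E)
  (hmn : (2 <= m < n)%N) (hdvd : ~~ (m %| n)%N)
  (hsuppF : supp F (dm0, dm%:R))
  (hdm0 : 0 < dm0 < dm%:R)
  (hedgeF : is_right_edge F (dm0, dm%:R) wF)
  (hslopeF : edge_slope p q (dm0, dm%:R) wF)
  (hratio0 : dn0 / dm0 = n%:R / m%:R)
  (hratio : dn%:R / dm%:R = n%:R / m%:R :> rat)
  (hedgeG : is_right_edge G (dn0, dn%:R) wG)
  (hslopeG : edge_slope p q (dn0, dn%:R) wG)
  (hdm : (2 <= dm)%N)
  (hcond : - (p%:R / q%:R) >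
    - (dm0 / dm%:R) + (dm%:R - dm0) / (dm%:R * (dm%:R + dn%:R - 1))) :
  one_irreducible_factor (edge_part F (dm0, dm%:R) wF) \/
  exists (alpha0 : R[i]) (ddm0 ddn0 : rat) (ddm ddn : nat),
    let F' := shift_y alpha0 (- (p%:R / q%:R)) F in
    let G' := shift_y alpha0 (- (p%:R / q%:R)) G in
    supp F' (ddm0, ddm%:R) /\ is_vertex F' (ddm0, ddm%:R) /\
    is_vertex G' (ddn0, ddn%:R) /\
    ddn0 / ddm0 = n%:R / m%:R /\ ddn%:R / ddm%:R = n%:R / m%:R :> rat /\
    0 < ddm0 < ddm%:R /\ (ddm < dm)%N /\ (2 <= ddm)%N.
Proof.
have r0 : 0 <= p%:R / q%:R :> rat by rewrite divr_ge0.
move: hcond; set r : rat := p%:R / q%:R => hcond.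
have [wFD] := @right_edge_wle R[i] r F p q _ _ erefl hedgeF hslopeF.
have [_] := @right_edge_wle R[i] r G p q _ _ erefl hedgeG hslopeG.
rewrite /= in wFD *; set D := dm0 - r * dm%:R in wFD *.
set DG := dn0 - r * dn%:R => DGG DF.
have m1 : 2 <= m%:R :> rat by rewrite ler_nat; case/andP: hmn.
have M2 : 2 <= dm%:R :> rat by rewrite ler_nat.
have m00 : m%:R != 0 :> rat by apply: lt0r_neq0; lra.
have M0 : dm%:R != 0 :> rat by apply: lt0r_neq0; lra.
case/andP: hdm0 => dm00 dm01.
pose e : rat := n%:R / m%:R.
have e_gt0 : 0 < e.
  have /andP[m2 mn] := hmn; have m_gt0 : (0 < m)%N by exact: leq_trans m2.
  by rewrite divr_gt0 ?ltr0n// (ltn_trans m_gt0).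
have e0 : 0 <= e by exact: ltW.
have dn0E : dn0 = e * dm0 by rewrite /e -hratio0 divfK// gt_eqF.
have dnE : dn%:R = e * dm%:R :> rat by rewrite /e -hratio divfK.
have DGE : DG = e * D by rewrite /DG /D dn0E dnE; ring.
have Q0 : 0 < dm%:R + dn%:R - 1 :> rat by rewrite dnE; nra.
(* Cleared of denominators, the slope hypothesis says D + DG + r - 1 > 0: the expected weight of
   [F, G] exceeds the weight 0 of a constant. *)
have hc : r * (dm%:R + dn%:R - 1) < dm0 + dn0 - 1.
  have dmQ0 : 0 < dm%:R * (dm%:R + dn%:R - 1) :> rat by rewrite mulr_gt0//; lra.
  have : (dm%:R - dm0) / (dm%:R * (dm%:R + dn%:R - 1)) < dm0 / dm%:R - r.
    by move: hcond; rewrite -/r; lra.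
  rewrite ltr_pdivrMr//.
  have -> : (dm0 / dm%:R - r) * (dm%:R * (dm%:R + dn%:R - 1)) =
      (dm0 - r * dm%:R) * (dm%:R + dn%:R - 1) by field.
  by rewrite dn0E dnE in Q0 *; nra.
(* Here [hc] reads (1 + e) D > 1 - r, and together with dm0 < dm it forces r < 1. *)
have D0 : 0 < D by rewrite /D; move: hc Q0; rewrite dn0E dnE; nra.
have DDG : 0 < D + DG + r - 1 by rewrite /D /DG; lra.
have r1 : r < 1 by have : 0 < D := D0; rewrite /D; nra.
have [hFv hFw wv _] := hedgeF; have [[hGv _] _ _ _] := hedgeG.
pose f := wlead r D F; pose g := wlead r DG G.
have vD : dm0 = D + r * dm%:R by rewrite /D; ring.
have fdm : f`_dm != 0.
  have [i [j [[iE /eqP]]]] := hsuppF; rewrite eqr_nat => /eqP jE Fj.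
  by rewrite /f coef_wlead -vD iE jE.
have f0 : f != 0 by apply: contraNneq fdm => ->; rewrite coef0.
have sf : size f = dm.+1.
  apply/eqP; rewrite eqn_leq; apply/andP; split.
    by apply: (@size_wlead_vertex _ r F D wF) => //; [rewrite -vD|case: hFw].
  by rewrite ltnNge; apply: contra fdm => /leq_sizeP->.
have g0 : g != 0.
  apply: (newton_region_wle _ hGv _ DGG); last by rewrite /= /DG; ring.
  by rewrite DGE mulr_gt0.
have [[c c0 FG] _ _] := hJ.
have fg : ratr D *: (f * g^`()) - ratr DG *: (f^`() * g) = 0.
  rewrite -wlead_bracket// FG; apply: (wlead_lt DDG); apply: wle_polyC => i i0.
  by rewrite pcoef_mono gt_eqF.
have sf1 : (1 < size f)%N by rewrite sf ltnS ltnW.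
have [s [t [S [T [sE S0 T0 fS fT]]]]] :=
  exists_noncommuting_leading_form FG c0 DF sf1.
have [rs fE] := closed_field_poly_normal f.
have srs : size rs = dm.
  have := congr1 (size \o (@polyseq _)) fE; rewrite /= sf size_scale ?lead_coef_eq0//.
  by rewrite size_prod_XsubC => -[].
have froot x : root f x = (x \in rs).
  by rewrite fE rootZ ?lead_coef_eq0// root_prod_XsubC.
case: rs => [|a rs] in fE srs froot; first by rewrite -srs in hdm.
(* A single root of f makes the edge part a power of one linear factor up to a unit; two distinct
   roots yield the new vertex. *)
have [/all_pred1P rsE|/allPn[b brs /= ba]] := boolP (all (pred1 a) rs).
  left; apply: (@one_irreducible_factor_edge_part _ r F D _ _ (lead_coef f) a dm) => //.
  - by rewrite -/f {1}fE -srs big_cons [in \prod_(_ <- _) _]rsE big_nseq iter_mulr_1 exprS.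
  - by rewrite lead_coef_eq0.
  - exact: ltnW.
right.
have fa : root f a by rewrite froot mem_head.
have fb : root f b by rewrite froot inE brs orbT.
have ab : a != b by rewrite eq_sym.
have [x fx heavy] := exists_heavy_root D0 r1 sE c0 S0 T0 f0 fS fT fa fb ab.
have mudm : (mup x f < dm)%N.
  have [y fy xy] : exists2 y, root f y & x != y.
    by have [->|xa] := eqVneq x a; [exists b | exists a].
  have y0 : (0 < mup y f)%N by rewrite -XsubC_dvd// dvdp_XsubCl.
  have us : uniq [:: x; y] by rewrite /= inE xy.
  have := sum_mup_le us f0; rewrite big_cons big_seq1 sf ltnS; apply: leq_trans.
  by rewrite -addn1 leq_add2l.
(* The vanishing Wronskian [fg] puts the multiplicities of f and g at x in the ratio D : DG = 1 :
   e. *)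
have mfg : DG * (mup x f)%:R = D * (mup x g)%:R.
  by rewrite (@weighted_wronskian_eq0 _ D DG f g).
set mu := mup x f in heavy mudm mfg *; set nu := mup x g in mfg *.
have nuE : nu%:R = e * mu%:R :> rat.
  by apply: (mulfI (lt0r_neq0 D0)); rewrite -mfg DGE; ring.
have mu0 : (0 < mu)%N by rewrite /mu -XsubC_dvd// dvdp_XsubCl.
have mu0' : 0 < mu%:R :> rat by rewrite ltr0n.
have ddm0 : 0 < D + r * mu%:R by rewrite ltr_wpDr// mulr_ge0.
(* Moving the root x to 0 makes mu and nu the lowest degrees of the two leading forms, hence the
   heights of vertices. The bound [heavy] says exactly that D + r mu < mu. *)
exists x, (D + r * mu%:R), (DG + r * nu%:R), mu, nu; rewrite /=.
have [DF' fE'] := wlead_shift x DF; have [DG' gE'] := wlead_shift x DGG.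
have [fmu flow] := coef_comp_XaddC_mup x f0.
have [gnu glow] := coef_comp_XaddC_mup x g0.
split; first by exists (D + r * mu%:R), mu; rewrite -coef_wlead fE'.
split; first by apply: is_vertex_wlead => //; rewrite ?fE' // => j /flow; rewrite fE'.
split.
  apply: is_vertex_wlead => //; first by rewrite DGE mulr_gt0.
    by rewrite gE'.
  by move=> j /glow; rewrite gE'.
split; first by rewrite DGE nuE -/e; field; rewrite gt_eqF.
split; first by rewrite nuE -/e mulfK// gt_eqF.
split; first by rewrite ddm0 /=; lra.
split=> //.
(* If mu were 1, then nu = n / m would be an integer, contrary to [hdvd]. *)
rewrite ltn_neqAle mu0 andbT; apply: contraNneq hdvd => mu1.
apply/dvdnP; exists nu; apply/eqP; rewrite -(eqr_nat rat) natrM nuE -mu1 mulr1.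
by rewrite /e divfK.
Qed.
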